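(* Let $H$ be a separable complex Hilbert space with $\dim H\ge 2$ and let $T\in B(H)$. Then $$\mathrm{dist}(T,\mathbb{C}\mathcal{U})=\begin{cases}\dfrac{\|T\|+m_{e}(T^{*})}{2} & \text{if }\dim\ker T>\dim\ker T^{*},\\[2mm] \dfrac{\|T\|+m_{e}(T)}{2} & \text{if }\dim\ker T<\dim\ker T^{*},\\[2mm] \dfrac{\|T\|-m(T)}{2} & \text{if }\dim\ker T=\dim\ker T^{*}.\end{cases}$$
   Context: $B(H)$ is the set of bounded linear operators on $H$, with operator norm $\|\cdot\|$. $\dim$ denotes Hilbert space dimension. $\mathcal{U}\subseteq B(H)$ is the set of unitary operators on $H$, $\mathbb{C}\mathcal{U}=\{\lambda U:\lambda\in\mathbb{C},U\in\mathcal{U}\}$, and $\mathrm{dist}(T,\mathcal{S})=\inf_{S\in\mathcal{S}}\|T-S\|$. The minimum modulus is $m(T)=\inf\{\|Tx\|:\|x\|=1\}$. $m_{e}(T)=\inf\{\lambda:\lambda\in\sigma_{e}(|T|)\}$, where $|T|=(T^{*}T)^{1/2}$ and $\sigma_e$ is the essential spectrum (the spectrum of the image in the Calkin algebra $B(H)/K(H)$). *)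

(* Defs.v *)
From HB Require Import structures.
From mathcomp Require Import all_boot all_order all_algebra.
From mathcomp Require Import sesquilinear complex.
From mathcomp Require Import all_classical all_reals all_analysis.

Set Implicit Arguments.
Unset Strict Implicit.
Unset Printing Implicit Defensive.

Import Order.TTheory GRing.Theory Num.Theory.
Import numFieldNormedType.Exports.

Local Open Scope classical_set_scope.
Local Open Scope card_scope.
Local Open Scope ring_scope.
Local Open Scope complex_scope.

(* Complex Hilbert spaces. The form is linear in its first argument and
   conjugate-linear in the second one. *)
HB.mixin Record CompleteNormedModule_isHilbert (R : realType) H
    of CompleteNormedModule R[i] H := {
  inner : {dot H for (@Num.conj R[i])} ;
  sqr_normE : forall x : H, `|x| ^+ 2 = inner x x
}.

#[short(type="hilbertType")]
HB.structure Definition Hilbert (R : realType) :=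
  {H of CompleteNormedModule R[i] H & CompleteNormedModule_isHilbert R H}.

Notation "'[ x , y ]" := (inner x y) : ring_scope.

Section Hilbert.
Context {R : realType} {H : hilbertType R}.
Implicit Types (T P U : H -> H) (M N A B : set H).

(* The library norm takes its (real) values in R[i]. *)
Definition rnorm (x : H) : R := complex.Re `|x|.

Definition separable_space := exists2 A : set H, countable A & dense A.

Definition orthonormal_set A :=
  forall x y, A x -> A y -> '[x, y] = (x == y)%:R.

(* Maximal orthonormal subsets of M; for M a closed subspace these are its
   orthonormal bases. *)
Definition orthonormal_basis M A :=
  [/\ A `<=` M, orthonormal_set A &
      forall x, M x -> (forall a, A a -> '[x, a] = 0) -> x = 0].

(* Comparisons of Hilbert space dimensions, i.e. of the cardinalities of
   orthonormal bases (all the orthonormal bases of a closed subspace are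
   equipotent). *)
Definition hdim_ge (n : nat) M :=
  exists2 A, orthonormal_basis M A & `I_n #<= A.
Definition hdim_eq M N :=
  exists A B, [/\ orthonormal_basis M A, orthonormal_basis N B & A #= B].
Definition hdim_lt M N :=
  exists A B, [/\ orthonormal_basis M A, orthonormal_basis N B,
                  A #<= B & ~ (B #<= A)].

Definition BH : set (H -> H) :=
  [set T | linear T /\ bounded_near T (nbhs (0 : H))].

Definition opnorm T : R := sup [set rnorm (T x) | x in [set x | rnorm x <= 1]].

(* For T in BH the adjoint exists (Riesz) and is unique. *)
Definition adjoint T : H -> H :=
  xget (fun=> 0) [set S | BH S /\ forall x y, '[T x, y] = '[x, S y]].

Definition ker T : set H := T @^-1` [set 0].

Definition positive_op P := forall x, 0 <= '[P x, x].

(* |T|, the unique positive square root of T^* T. *)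
Definition absop T : H -> H :=
  xget (fun=> 0)
    [set P | [/\ BH P, positive_op P & P \o P = adjoint T \o T]].

Definition unitary : set (H -> H) :=
  [set U | [/\ BH U, U \o adjoint U = id & adjoint U \o U = id]].

Definition scaled_unitary : set (H -> H) :=
  [set (fun x => l *: U x) | l in [set: R[i]] & U in unitary].

Definition opdist T (S : set (H -> H)) : R :=
  inf [set opnorm (T \- A) | A in S].

Definition min_modulus T : R :=
  inf [set rnorm (T x) | x in [set x | rnorm x = 1]].

Definition KH : set (H -> H) :=
  [set T | BH T /\ precompact (T @` [set x | rnorm x <= 1])].

(* Equality of the classes of two bounded operators in the Calkin algebra
   BH / KH. *)
Definition calkin_eq T S := KH (T \- S).

Definition calkin_unit T :=
  exists S, [/\ BH S, calkin_eq (T \o S) id & calkin_eq (S \o T) id].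

Definition ess_spectrum T : set R[i] :=
  [set l | ~ calkin_unit (fun x => T x - l *: x)].

(* The essential spectrum of |T| consists of nonnegative reals. It is empty
   exactly when H is finite-dimensional, in which case inf returns the junk
   value 0 (instead of +oo). *)
Definition ess_min_modulus T : R :=
  inf [set l : R | ess_spectrum (absop T) l%:C].

End Hilbert.

Arguments separable_space {R} H.
Arguments scaled_unitary {R} H.

(* Main.v *)
(* Write l U = r U' with r = |l|. The bounds |T - l U| >= |T| - r and
   |T - l U| >= r - m(T) are immediate. If dim ker T < dim ker T^*, then for
   t < m_e(T) the operator U'^* T + t is left semi-Fredholm with the same
   negative index as U'^* T, so it is not invertible, although it is the sum of
   r + t and of an operator of norm |T - l U|; hence |T - l U| >= r + m_e(T).
   The resulting lower bounds are attained, up to any e > 0, as follows. Let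
   P = |T|. If the kernels of T and T^* have the same dimension, T = V P with V
   unitary, and one takes a multiple of V. If dim ker T < dim ker T^*, T = V P
   with V a non-surjective isometry; since al = m_e(T) belongs to the essential
   spectrum of P, there is an infinite-dimensional subspace on which P is close
   to al, and V can be modified on it into a unitary operator. The remaining
   case follows by taking adjoints. *)

Require Import Defs.
From HB Require Import structures.
From mathcomp Require Import all_boot all_order all_algebra.
From mathcomp Require Import sesquilinear complex.
From mathcomp Require Import all_classical all_reals all_analysis.
From mathcomp Require Import ring lra.

Set Implicit Arguments.
Unset Strict Implicit.
Unset Printing Implicit Defensive.

Import Order.TTheory GRing.Theory Num.Theory.
Import numFieldNormedType.Exports.

Local Open Scope classical_set_scope.
Local Open Scope card_scope.
Local Open Scope complex_scope.
Local Open Scope ring_scope.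

(** * Inner product and norm *)

(** The index argument is reduced to linear algebra: if K has finite rank and 1 - K is injective,
    then 1 - K is onto ([fredholm]). Spectral subspaces of P are replaced by sequences of
    approximate eigenvectors whose errors are mutually orthogonal. The number m_e is handled by a
    max-min formula, the supremum over finite sets F of the infimum of |P x| over unit vectors x
    orthogonal to F. It yields both the lower bounds on complements of finite sets and the
    approximate eigenvectors orthogonal to any finite set. Separability acts twice: it makes the
    strictly smaller kernel finite-dimensional, and it gives equipotent countable bases to the two
    spaces matched when V is modified. Unequal kernels force H to be infinite-dimensional, which
    excludes the default value of m_e. The modulus of the multiple balances two lower bounds: |T| -
    r = r + m_e at r = (|T| - m_e) / 2, and |T| - r = r - m at r = (|T| + m) / 2. *)

Section InnerProduct.
Context {R : realType} {H : hilbertType R}.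
Implicit Types (x y z : H) (a b : R[i]).

Lemma innerDl x y z : '[x + y, z] = '[x, z] + '[y, z].
Proof. exact: linearDl. Qed.

Lemma innerDr x y z : '[x, y + z] = '[x, y] + '[x, z].
Proof. exact: linearDr. Qed.

Lemma innerZl a x y : '[a *: x, y] = a * '[x, y].
Proof. exact: linearZl_LR. Qed.

Lemma innerC x y : '[x, y] = ('[y, x])^*.
Proof. by rewrite (hermC inner) /= expr0 mul1r. Qed.

Lemma innerZr a x y : '[x, a *: y] = a^* * '[x, y].
Proof. by rewrite innerC innerZl rmorphM /= -innerC. Qed.

Lemma inner0l x : '[0, x] = 0.
Proof. by rewrite -(scale0r 0) innerZl mul0r. Qed.

Lemma inner0r x : '[x, 0] = 0.
Proof. by rewrite innerC inner0l rmorph0. Qed.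

Lemma innerNl x y : '[- x, y] = - '[x, y].
Proof. by rewrite -scaleN1r innerZl mulN1r. Qed.

Lemma innerNr x y : '[x, - y] = - '[x, y].
Proof. by rewrite innerC innerNl rmorphN /= -innerC. Qed.

Lemma innerBl x y z : '[x - y, z] = '[x, z] - '[y, z].
Proof. by rewrite innerDl innerNl. Qed.

Lemma innerBr x y z : '[x, y - z] = '[x, y] - '[x, z].
Proof. by rewrite innerDr innerNr. Qed.

Lemma inner_suml I (r : seq I) (P : pred I) (f : I -> H) y :
  '[\sum_(i <- r | P i) f i, y] = \sum_(i <- r | P i) '[f i, y].
Proof.
elim/big_rec2: _ => [|i u v _ <-]; first exact: inner0l.
exact: innerDl.
Qed.

Lemma inner_sumr I (r : seq I) (P : pred I) (f : I -> H) y :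
  '[y, \sum_(i <- r | P i) f i] = \sum_(i <- r | P i) '[y, f i].
Proof.
elim/big_rec2: _ => [|i u v _ <-]; first exact: inner0r.
exact: innerDr.
Qed.

Lemma inner_eq0 x : '[x, x] = 0 -> x = 0.
Proof.
by rewrite -sqr_normE => /eqP; rewrite expf_eq0/= normr_eq0 => /eqP.
Qed.

Lemma norm_rnorm x : `|x| = (rnorm x)%:C.
Proof. by rewrite /rnorm RRe_real // normr_real. Qed.

Lemma rnorm_ge0 x : 0 <= rnorm x.
Proof. by rewrite -lecR -norm_rnorm normr_ge0. Qed.

Lemma rnormD x y : rnorm (x + y) <= rnorm x + rnorm y.
Proof. by rewrite -lecR rmorphD/= -!norm_rnorm ler_normD. Qed.

Lemma rnormN x : rnorm (- x) = rnorm x.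
Proof. by rewrite /rnorm normrN. Qed.

Lemma rnormBC x y : rnorm (x - y) = rnorm (y - x).
Proof. by rewrite -rnormN opprB. Qed.

Lemma rnormB x y : rnorm (x - y) <= rnorm x + rnorm y.
Proof. by rewrite (le_trans (rnormD _ _)) // rnormN. Qed.

Lemma rnorm_lerB x y : rnorm x - rnorm y <= rnorm (x - y).
Proof. by rewrite lerBlDr -{1}(subrK y x) rnormD. Qed.

Lemma rnorm_dist y x z : rnorm (x - z) <= rnorm (x - y) + rnorm (y - z).
Proof. by have := rnormD (x - y) (y - z); rewrite addrA subrK. Qed.

Lemma rnorm0 : rnorm (0 : H) = 0.
Proof. by rewrite /rnorm normr0. Qed.

Lemma rnorm_eq0 x : rnorm x = 0 -> x = 0.
Proof. by move=> h; apply/eqP; rewrite -normr_eq0 norm_rnorm h. Qed.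

Lemma rnorm_gt0 x : x != 0 -> 0 < rnorm x.
Proof.
move=> x0; rewrite lt_neqAle rnorm_ge0 andbT eq_sym.
by apply: contra x0 => /eqP/rnorm_eq0 ->.
Qed.

Definition cabs (a : R[i]) : R := complex.Re `|a|.

Lemma norm_cabs a : `|a| = (cabs a)%:C.
Proof. by rewrite /cabs RRe_real // normr_real. Qed.

Lemma cabs_ge0 a : 0 <= cabs a.
Proof. by rewrite -lecR -norm_cabs normr_ge0. Qed.

Lemma cabs_eq0 a : (cabs a == 0) = (a == 0).
Proof. by rewrite -(inj_eq (@complexI _)) -norm_cabs normr_eq0. Qed.

Lemma cabsM a b : cabs (a * b) = cabs a * cabs b.
Proof. by apply: complexI; rewrite rmorphM -!norm_cabs normrM. Qed.

Lemma cabsV a : cabs (a^-1) = (cabs a)^-1.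
Proof. by apply: complexI; rewrite fmorphV -!norm_cabs normfV. Qed.

Lemma cabsR (r : R) : cabs r%:C = `|r|.
Proof. by rewrite /cabs normc_def /= expr0n addr0 sqrtr_sqr. Qed.

Lemma cabsJ a : cabs a^* = cabs a.
Proof. by rewrite /cabs norm_conjC. Qed.

Lemma mulcJ a : a * a^* = (cabs a ^+ 2)%:C.
Proof. by rewrite -normCK norm_cabs rmorphXn. Qed.

Lemma Re_le_cabs a : complex.Re a <= cabs a.
Proof.
rewrite /cabs normc_def /=; apply: (le_trans (ler_norm _)).
by rewrite -sqrtr_sqr ler_sqrt ?lerDl ?addr_ge0 ?sqr_ge0.
Qed.

Lemma rnormZ a x : rnorm (a *: x) = cabs a * rnorm x.
Proof. by apply: complexI; rewrite rmorphM -norm_rnorm normrZ norm_cabs norm_rnorm. Qed.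

Definition rdot x y : R := complex.Re '[x, y].

Lemma inner_rnorm x : '[x, x] = (rnorm x ^+ 2)%:C.
Proof. by rewrite -sqr_normE norm_rnorm rmorphXn. Qed.

Lemma rdotxx x : rdot x x = rnorm x ^+ 2.
Proof. by rewrite /rdot inner_rnorm. Qed.

Lemma rdotC x y : rdot x y = rdot y x.
Proof. by rewrite /rdot innerC; case: '[y, x]. Qed.

Lemma rdotDl x y z : rdot (x + y) z = rdot x z + rdot y z.
Proof. by rewrite /rdot innerDl; case: '[x, z] => ? ?; case: '[y, z]. Qed.

Lemma rdotDr x y z : rdot x (y + z) = rdot x y + rdot x z.
Proof. by rewrite rdotC rdotDl !(rdotC x). Qed.

Lemma rdotNl x y : rdot (- x) y = - rdot x y.
Proof. by rewrite /rdot innerNl; case: '[x, y]. Qed.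

Lemma rdotNr x y : rdot x (- y) = - rdot x y.
Proof. by rewrite rdotC rdotNl rdotC. Qed.

Lemma rdotBl x y z : rdot (x - y) z = rdot x z - rdot y z.
Proof. by rewrite rdotDl rdotNl. Qed.

Lemma rdotBr x y z : rdot x (y - z) = rdot x y - rdot x z.
Proof. by rewrite rdotDr rdotNr. Qed.

Lemma rdotZl (r : R) x y : rdot (r%:C *: x) y = r * rdot x y.
Proof. by rewrite /rdot innerZl; case: '[x, y] => p q /=; rewrite mul0r subr0. Qed.

Lemma rdotZr (r : R) x y : rdot x (r%:C *: y) = r * rdot x y.
Proof. by rewrite rdotC rdotZl rdotC. Qed.

Lemma rdot0l x : rdot 0 x = 0.
Proof. by rewrite /rdot inner0l. Qed.

Lemma rdot0r x : rdot x 0 = 0.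
Proof. by rewrite /rdot inner0r. Qed.

Lemma rnormD2 x y : rnorm (x + y) ^+ 2 = rnorm x ^+ 2 + 2 * rdot x y + rnorm y ^+ 2.
Proof. rewrite -!rdotxx rdotDl !rdotDr (rdotC y x); ring. Qed.

Lemma rnormB2 x y : rnorm (x - y) ^+ 2 = rnorm x ^+ 2 - 2 * rdot x y + rnorm y ^+ 2.
Proof. by rewrite rnormD2 rdotNr rnormN mulrN. Qed.

Lemma rdot_inner x y : '[x, y] = 0 -> rdot x y = 0.
Proof. by rewrite /rdot => ->. Qed.

Lemma pythagoras x y : '[x, y] = 0 ->
  rnorm (x + y) ^+ 2 = rnorm x ^+ 2 + rnorm y ^+ 2.
Proof. by move=> h; rewrite rnormD2 rdot_inner // mulr0 addr0. Qed.

Lemma conj_imaginary : Num.conj ('i%C : R[i]) = - 'i%C.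
Proof. by apply/eqP; rewrite eq_complex /= oppr0 !eqxx. Qed.

Lemma conj_real (r : R) : Num.conj r%:C = r%:C :> R[i].
Proof. by apply/eqP; rewrite eq_complex /= oppr0 !eqxx. Qed.

Lemma inner_rdot x y : '[x, y] = (rdot x y)%:C + 'i%C * (rdot x ('i%C *: y))%:C.
Proof.
rewrite {1}(complexE '[x, y]) /rdot; congr (_ + 'i%C * _%:C).
rewrite innerZr; case: '[x, y] => p q.
by rewrite conj_imaginary /= ?(mul0r, oppr0, mulN1r, add0r, sub0r, opprK).
Qed.

(** Expanding the squared norm of |y| x - |x| y gives 2 |x| |y| (|x| |y| - rdot x y). *)
Lemma cauchy_schwarz x y : rdot x y <= rnorm x * rnorm y.
Proof.
have [->|y0] := eqVneq y 0; first by rewrite rdot0r rnorm0 mulr0.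
have y1 := rnorm_gt0 y0.
have h : 0 <= rnorm ((rnorm y)%:C *: x - (rnorm x)%:C *: y) ^+ 2 by exact: sqr_ge0.
have [x0|x1] := eqVneq x 0; first by rewrite x0 rdot0l rnorm0 mul0r.
have {}x1 := rnorm_gt0 x1.
move: h; rewrite rnormB2 rdotZl rdotZr !rnormZ !cabsR !ger0_norm ?rnorm_ge0 //.
move=> h.
have : 0 <= rnorm y * rnorm x * (rnorm x * rnorm y - rdot x y) by nra.
by rewrite pmulr_rge0 ?mulr_gt0 // subr_ge0.
Qed.

Lemma cauchy_schwarz_inner x y : cabs '[x, y] <= rnorm x * rnorm y.
Proof.
have [h0|h0] := eqVneq '[x, y] 0.
  by rewrite h0 /cabs normr0 /= mulr_ge0 // rnorm_ge0.
(* The phase [b] has modulus one and turns [a] into its modulus, so the bound on real parts applies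
   to b x. *)
set a : R[i] := '[x, y]; pose b : R[i] := a^* / (cabs a)%:C.
have ca : (cabs a)%:C != 0 by rewrite -norm_cabs normr_eq0.
have ba : b * a = (cabs a)%:C.
  by rewrite /b mulrAC (mulrC _ a) mulcJ rmorphXn expr2 mulfK.
have := cauchy_schwarz (b *: x) y.
rewrite /rdot innerZl -/a ba /= /b.
rewrite rnormZ cabsM cabsJ cabsV cabsR ger0_norm ?cabs_ge0 // divff ?mul1r //.
by rewrite cabs_eq0.
Qed.

Lemma inner_ext x : (forall y, '[x, y] = 0) -> x = 0.
Proof. by move=> h; apply: inner_eq0. Qed.

Lemma parallelogram x y :
  rnorm (x + y) ^+ 2 + rnorm (x - y) ^+ 2 = 2 * rnorm x ^+ 2 + 2 * rnorm y ^+ 2.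
Proof. rewrite rnormD2 rnormB2; ring. Qed.

End InnerProduct.

(** * Bounded operators and convergence of sequences *)

Section BoundedOperators.
Context {R : realType} {H : hilbertType R}.
Implicit Types (x y z : H) (T S : H -> H).

Lemma le_eps (a b : R) : (forall e : R, 0 < e -> a <= b + e) -> a <= b.
Proof. by move=> h; apply/ler_addgt0Pr. Qed.

Lemma ler_sqr_nneg (a b : R) : 0 <= a -> 0 <= b -> a ^+ 2 <= b ^+ 2 -> a <= b.
Proof. by move=> a0 b0; rewrite ler_pXn2r. Qed.

Lemma eqr_sqr_nneg (a b : R) : 0 <= a -> 0 <= b -> a ^+ 2 = b ^+ 2 -> a = b.
Proof.
move=> a0 b0 ab; apply: le_anti; apply/andP.
by split; apply: ler_sqr_nneg => //; rewrite ab.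
Qed.

Lemma ex_invn_lt (e : R) : 0 < e -> exists N : nat, N.+1%:R^-1 < e.
Proof.
move=> e0; exists (Num.truncn e^-1).
by rewrite invf_plt ?posrE //; exact: truncnS_gt.
Qed.

Lemma BHP T : BH T <-> linear T /\ exists M : R, forall x, rnorm (T x) <= M * rnorm x.
Proof.
split=> -[lT bT]; split => //.
  pose f : {linear H -> H} := HB.pack T (GRing.isLinear.Build _ _ _ _ T lT).
  have /linear_boundedP/pinfty_ex_gt0[M M0 hM] : bounded_near f (nbhs 0) by [].
  exists (complex.Re M) => x; rewrite -lecR rmorphM /= -!norm_rnorm.
  by rewrite RRe_real ?gtr0_real //; exact: hM.
case: bT => M hM; apply/ex_bound; exists (`|M|)%:C.
apply/nbhs_norm0P; exists 1 => //= x x1.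
rewrite /= norm_rnorm lecR (le_trans (hM x)) //.
move: x1; rewrite /= norm_rnorm (ltcR _ 1) => x1.
rewrite (le_trans (ler_wpM2r (rnorm_ge0 _) (ler_norm _))) //.
by rewrite ler_piMr // ltW.
Qed.

Lemma BH_bound T : BH T -> exists2 M : R, 0 <= M & forall x, rnorm (T x) <= M * rnorm x.
Proof.
move=> /BHP[_ [M hM]]; exists `|M| => // x.
by rewrite (le_trans (hM x)) // ler_wpM2r ?rnorm_ge0 ?ler_norm.
Qed.

Lemma BH_linear T : BH T -> linear T.
Proof. by case/BHP. Qed.

Lemma BHD T : BH T -> {morph T : x y / x + y}.
Proof. by move=> /BH_linear h x y; have := h 1 x y; rewrite !scale1r. Qed.

Lemma BH0 T : BH T -> T 0 = 0.
Proof. by move=> h; apply: (addIr (T 0)); rewrite -(BHD h) !add0r. Qed.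

Lemma BHZ T : BH T -> forall a x, T (a *: x) = a *: T x.
Proof.
move=> h a x; have := BH_linear h a x 0.
by rewrite !addr0 => ->; rewrite (BH0 h) addr0.
Qed.

Lemma BHN T : BH T -> {morph T : x / - x}.
Proof. by move=> h x; rewrite -scaleN1r (BHZ h) scaleN1r. Qed.

Lemma BHB T : BH T -> {morph T : x y / x - y}.
Proof. by move=> h x y; rewrite (BHD h) (BHN h). Qed.

Lemma BH_sum T : BH T -> forall I (r : seq I) (P : pred I) (f : I -> H),
  T (\sum_(i <- r | P i) f i) = \sum_(i <- r | P i) T (f i).
Proof.
move=> h I r P f; elim/big_rec2: _ => [|i u v _ <-]; first exact: (BH0 h).
by rewrite (BHD h).
Qed.

Lemma BH_id : BH (@id H).
Proof. by apply/BHP; split => //; exists 1 => x; rewrite mul1r. Qed.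

Lemma BH_cst0 : BH (fun=> 0 : H).
Proof.
apply/BHP; split => [a x y|]; first by rewrite scaler0 addr0.
by exists 0 => x; rewrite mul0r rnorm0.
Qed.

Lemma BH_comp T S : BH T -> BH S -> BH (T \o S).
Proof.
move=> hT hS; apply/BHP; split.
  by move=> a x y; rewrite /= (BH_linear hS) (BH_linear hT).
have [M M0 hM] := BH_bound hT; have [N N0 hN] := BH_bound hS.
exists (M * N) => x /=; rewrite (le_trans (hM _)) // -mulrA.
by rewrite ler_wpM2l.
Qed.

Lemma BH_add T S : BH T -> BH S -> BH (fun x => T x + S x).
Proof.
move=> hT hS; apply/BHP; split.
  move=> a x y; rewrite (BH_linear hS) (BH_linear hT) scalerDr.
  by rewrite !addrA; congr (_ + _); rewrite -!addrA; congr (_ + _); exact: addrC.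
have [M M0 hM] := BH_bound hT; have [N N0 hN] := BH_bound hS.
exists (M + N) => x; rewrite (le_trans (rnormD _ _)) // mulrDl.
by rewrite lerD.
Qed.

Lemma BH_scale a T : BH T -> BH (fun x => a *: T x).
Proof.
move=> hT; apply/BHP; split.
  by move=> b x y; rewrite (BH_linear hT) scalerDr !scalerA (mulrC a).
have [M M0 hM] := BH_bound hT.
by exists (cabs a * M) => x; rewrite rnormZ -mulrA ler_wpM2l ?cabs_ge0.
Qed.

Lemma BH_opp T : BH T -> BH (fun x => - T x).
Proof.
move=> /(BH_scale (-1)); congr BH; apply: funext => x.
by rewrite scaleN1r.
Qed.

Lemma BH_sub T S : BH T -> BH S -> BH (fun x => T x - S x).
Proof. by move=> hT hS; exact: (BH_add hT (BH_opp hS)). Qed.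

Lemma BH_rank1 u v : BH (fun x => '[x, u] *: v).
Proof.
apply/BHP; split.
  by move=> a x y; rewrite innerDl innerZl scalerDl scalerA.
exists (rnorm u * rnorm v) => x; rewrite rnormZ mulrAC ler_wpM2r ?rnorm_ge0 //.
by rewrite (le_trans (cauchy_schwarz_inner _ _)) // mulrC.
Qed.

Lemma BH_bigsum I (r : seq I) (F : I -> H -> H) :
  (forall i, BH (F i)) -> BH (fun x => \sum_(i <- r) F i x).
Proof.
move=> hF; elim: r => [|i r ih].
  by have := BH_cst0; congr BH; apply: funext => x; rewrite big_nil.
have := BH_add (hF i) ih; congr BH; apply: funext => x; by rewrite big_cons.
Qed.

Lemma opnorm_has_sup T : BH T ->
  has_sup [set rnorm (T x) | x in [set x : H | rnorm x <= 1]].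
Proof.
move=> hT; split.
  by exists (rnorm (T 0)), 0 => //=; rewrite rnorm0 ler01.
have [M M0 hM] := BH_bound hT; exists M => _ /= [x x1 <-].
by rewrite (le_trans (hM x)) // ler_piMr.
Qed.

Lemma opnormP T x : BH T -> rnorm (T x) <= opnorm T * rnorm x.
Proof.
move=> hT; have [->|x0] := eqVneq x 0.
  by rewrite (BH0 hT) rnorm0 mulr0.
have x1 := rnorm_gt0 x0.
rewrite -ler_pdivrMr // mulrC.
have := ub_le_sup (opnorm_has_sup hT).2; apply.
exists ((rnorm x)^-1%:C *: x) => /=.
  by rewrite rnormZ cabsR ger0_norm ?invr_ge0 ?rnorm_ge0 // mulVf ?gt_eqF.
by rewrite (BHZ hT) rnormZ cabsR ger0_norm ?invr_ge0 ?rnorm_ge0.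
Qed.

Lemma opnorm_le T (c : R) : 0 <= c -> (forall x, rnorm (T x) <= c * rnorm x) ->
  opnorm T <= c.
Proof.
move=> c0 h; apply: ge_sup; first by exists (rnorm (T 0)), 0 => //=; rewrite rnorm0 ler01.
by move=> _ /= [x x1 <-]; rewrite (le_trans (h x)) // ler_piMr.
Qed.

Lemma opnorm_ge0 T : BH T -> 0 <= opnorm T.
Proof.
move=> hT; apply: (le_trans (rnorm_ge0 (T 0))).
by apply: ub_le_sup (opnorm_has_sup hT).2 _ _; exists 0 => //=; rewrite rnorm0 ler01.
Qed.

(** Real tolerances keep the estimates in the ordered field [R], whereas the library norm takes its
    values in R[i]. *)
Definition scvg (u : nat -> H) (l : H) :=
  forall e : R, 0 < e -> exists N, forall n, (N <= n)%N -> rnorm (u n - l) < e.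

Lemma hilbert_complete (u : nat -> H) :
    (forall e : R, 0 < e -> exists N, forall n, (N <= n)%N -> rnorm (u n - u N) < e) ->
  exists l, scvg u l.
Proof.
move=> hu.
have cu : cauchy (u @ \oo).
  apply: cauchy_exP => e e0.
  have [|N hN] := hu (complex.Re e); first by move: e0; rewrite ltcE => /andP[].
  exists (u N); exists N => // n /= Nn; rewrite -ball_normE /= norm_rnorm rnormBC.
  by rewrite -(RRe_real (gtr0_real e0)) ltcR; exact: hN.
have /cauchy_cvg/cvg_ex[l hl] := cu.
exists l => e e0.
have e0' : 0 < e%:C by rewrite (ltcR 0).
have /cvgrPdist_lt/(_ _ e0')[N _ hN] := hl.
exists N => n Nn; have := hN n Nn.
by rewrite norm_rnorm ltcR rnormBC.
Qed.

Lemma scvg_unique u l l' : scvg u l -> scvg u l' -> l = l'.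
Proof.
move=> h h'; apply/eqP; rewrite -subr_eq0; apply/negP => /negP ll.
have e0 : 0 < rnorm (l - l') / 2 by rewrite divr_gt0 ?rnorm_gt0.
have [N hN] := h _ e0; have [N' hN'] := h' _ e0.
have := hN _ (leq_maxl N N'); have := hN' _ (leq_maxr N N').
set n := maxn N N' => h1 h2.
have : rnorm (l - l') <= rnorm (u n - l') + rnorm (u n - l).
  by rewrite [leRHS]addrC (rnormBC (u n) l) rnorm_dist.
lra.
Qed.

Lemma scvg_BH T u l : BH T -> scvg u l -> scvg (T \o u) (T l).
Proof.
move=> hT h e e0; have [M M0 hM] := BH_bound hT.
have [|N hN] := h (e / (M + 1)); first by rewrite divr_gt0 // ltr_wpDl.
exists N => n /hN; rewrite /= -(BHB hT) ltr_pdivlMr ?ltr_wpDl // => h1.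
apply: le_lt_trans (hM _) _; rewrite mulrC; apply: le_lt_trans h1.
by rewrite mulrDr mulr1 lerDl rnorm_ge0.
Qed.

Lemma scvg_add u v l m : scvg u l -> scvg v m -> scvg (fun n => u n + v n) (l + m).
Proof.
move=> h h' e e0; have e2 : 0 < e / 2 by rewrite divr_gt0.
have [N hN] := h _ e2; have [N' hN'] := h' _ e2.
exists (maxn N N') => n; rewrite geq_max => /andP[/hN h1 /hN' h2].
have := rnormD (u n - l) (v n - m); rewrite opprD addrACA; lra.
Qed.

Lemma scvg_le (u : nat -> H) l (f : H -> H) (c : R) : (forall x z, f x - f z = x - z) ->
  scvg u l -> (forall n, rnorm (f (u n)) <= c) -> rnorm (f l) <= c.
Proof.
move=> hf h hc; apply: le_eps => e e0.
have [N hN] := h _ e0; have := hN N (leqnn _); rewrite -hf => h1.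
have := hc N; have := rnormB (f (u N)) (f (u N) - f l).
by rewrite subKr; lra.
Qed.

Lemma scvg_norm u l (c : R) : scvg u l -> (forall n, rnorm (u n) <= c) -> rnorm l <= c.
Proof. exact: (@scvg_le u l id). Qed.

End BoundedOperators.
(** * Projections, adjoints and inverses *)

Section Projection.
Context {R : realType} {H : hilbertType R}.
Implicit Types (x y z : H) (T S : H -> H) (M : set H).

Definition closed_subspace M :=
  [/\ M 0, forall a x y, M x -> M y -> M (a *: x + y) &
      forall u l, (forall n : nat, M (u n)) -> scvg u l -> M l].

(** A minimizing sequence is Cauchy by the parallelogram law. At the minimizer the first variation
    along [y] and along i y kills both parts of the inner product. *)
Lemma projection M x : closed_subspace M ->
  exists p, M p /\ forall y, M y -> '[x - p, y] = 0.
Proof.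
move=> [M0 ML Mc].
have MD y z : M y -> M z -> M (y + z) by move=> My Mz; rewrite -(scale1r y); exact: ML.
have MZ a y : M y -> M (a *: y) by move=> My; rewrite -(addr0 (_ *: _)); exact: ML.
pose D := [set rnorm (x - y) | y in M]; pose d := inf D.
have hD : has_inf D.
  split; first by exists (rnorm (x - 0)), 0.
  by exists 0 => _ [y _ <-]; exact: rnorm_ge0.
have dle y : M y -> d <= rnorm (x - y).
  by move=> My; apply: ge_inf hD.2 _ _; exists y.
have d0 : 0 <= d by apply: lb_le_inf; [exact: hD.1 | move=> _ [y _ <-]; exact: rnorm_ge0].
have ex n : exists y, M y /\ rnorm (x - y) < d + n.+1%:R^-1.
  have n0 : 0 < n.+1%:R^-1 :> R by rewrite invr_gt0.
  have [_ [y My <-] h] := inf_adherent n0 hD.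
  by exists y.
have [u hu] := choice ex.
(* The midpoint of [y] and [z] lies in [M], hence at distance at least [d] from [x]; the bound is 4
   (d + e)^2 - 4 d^2. *)
have key y z (e : R) : M y -> M z -> rnorm (x - y) < d + e -> rnorm (x - z) < d + e ->
    rnorm (y - z) ^+ 2 <= 8 * d * e + 4 * e ^+ 2.
  move=> My Mz hy hz.
  have := parallelogram (x - z) (x - y).
  have -> : x - z - (x - y) = y - z by rewrite opprB addrC addrA subrK.
  have -> : x - z + (x - y) = 2%:R *: (x - 2^-1 *: (y + z)).
    rewrite scalerBr scalerA divff ?pnatr_eq0 // scale1r scaler_nat mulr2n.
    by rewrite opprD addrACA (addrC (- z)).
  rewrite rnormZ.
  have -> : cabs 2%:R = 2 :> R by rewrite -(rmorph_nat (real_complex R)) cabsR ger0_norm.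
  have h : d <= rnorm (x - 2^-1 *: (y + z)) by apply/dle/MZ/MD.
  have := rnorm_ge0 (x - y); have := rnorm_ge0 (x - z).
  by move: h hy hz d0; nra.
have cu (e : R) : 0 < e -> exists N, forall n, (N <= n)%N -> rnorm (u n - u N) < e.
  move=> e0.
  (* For tolerances t <= 1 the bound of [key] is at most k t. *)
  pose k := 8 * d + 4; have k0 : 0 < k by rewrite /k; lra.
  have e2 : 0 < e ^+ 2 / k by rewrite divr_gt0 ?exprn_gt0.
  have [N hN] := ex_invn_lt e2.
  exists N => n Nn.
  have hNn : rnorm (x - u n) < d + N.+1%:R^-1.
    apply: lt_le_trans (hu n).2 _; rewrite lerD2l lef_pV2 ?posrE ?ltr0Sn //.
    by rewrite ler_nat ltnS.
  have := key _ _ _ (hu n).1 (hu N).1 hNn (hu N).2.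
  set t := N.+1%:R^-1 in hN *.
  have t0 : 0 < t by rewrite invr_gt0.
  have t1 : t <= 1 by rewrite invf_le1 ?ltr0Sn // ler1n.
  rewrite ltr_pdivlMr // in hN => h.
  have : rnorm (u n - u N) ^+ 2 < e ^+ 2 by rewrite /k in hN; nra.
  by rewrite ltr_pXn2r ?nnegrE ?rnorm_ge0 // ltW.
have [p hp] := hilbert_complete cu.
have Mp : M p by apply: Mc hp => n; exact: (hu n).1.
have dp : rnorm (x - p) <= d.
  apply: le_eps => e e0.
  have e2 : 0 < e / 2 by rewrite divr_gt0.
  have [N hN] := hp _ e2.
  have [K hK] := ex_invn_lt e2.
  pose n := maxn N K.
  have h1 := hN n (leq_maxl _ _).
  have h2 : n.+1%:R^-1 <= K.+1%:R^-1 :> R.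
    by rewrite lef_pV2 ?posrE ?ltr0Sn // ler_nat ltnS leq_maxr.
  move: (hu n).2 hK h2; set s := n.+1%:R^-1; set t := K.+1%:R^-1.
  have := rnorm_dist (u n) x p; lra.
exists p; split => //.
have ortho_re y : M y -> rdot (x - p) y = 0.
  move=> My; set c := rdot _ _.
  have h (t : R) : 0 <= - 2 * t * c + t ^+ 2 * rnorm y ^+ 2.
    have := dle _ (MD _ _ Mp (MZ t%:C _ My)); rewrite opprD addrA => h.
    have : rnorm (x - p) ^+ 2 <= rnorm (x - p - t%:C *: y) ^+ 2.
      by rewrite ler_pXn2r ?nnegrE ?rnorm_ge0 // (le_trans dp).
    by rewrite (rnormB2 (x - p)) rdotZr rnormZ cabsR exprMn real_normK ?num_real // -/c; lra.
  have [y0|y0] := eqVneq y 0; first by rewrite /c y0 rdot0r.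
  have y1 := rnorm_gt0 y0.
  (* This value minimizes the quadratic in [t] and leaves - c^2 / |y|^2, which forces c = 0. *)
  have := h (c / rnorm y ^+ 2).
  have -> : - 2 * (c / rnorm y ^+ 2) * c + (c / rnorm y ^+ 2) ^+ 2 * rnorm y ^+ 2
     = - (c ^+ 2 / rnorm y ^+ 2) by field; rewrite gt_eqF.
  rewrite oppr_ge0 pmulr_lle0 ?invr_gt0 ?exprn_gt0 // => h1.
  by apply/eqP; rewrite -sqrf_eq0 eq_le h1 sqr_ge0.
by move=> y My; rewrite inner_rdot !ortho_re ?rmorph0 ?mulr0 ?addr0 //; exact: MZ.
Qed.

(** A vector [z] orthogonal to the kernel with f z nonzero represents [f] up to a scalar, because f
    z x - f x z lies in the kernel for every [x]. *)
Lemma riesz (f : H -> R[i]) : (forall a x y, f (a *: x + y) = a * f x + f y) ->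
    (exists C : R, forall x, cabs (f x) <= C * rnorm x) ->
  exists y, forall x, f x = '[x, y].
Proof.
move=> lf [C hC].
have f0 : f 0 = 0 by have := lf (-1) 0 0; rewrite scaler0 addr0 mulN1r addNr.
have fZ a x : f (a *: x) = a * f x by rewrite -(addr0 (_ *: _)) lf f0 addr0.
have fD x y : f (x + y) = f x + f y by rewrite -{1}(scale1r x) lf mul1r.
have fB x y : f (x - y) = f x - f y by rewrite fD -scaleN1r fZ mulN1r.
have cM : closed_subspace [set x | f x = 0].
  split => //= [a x y|u l hu ul]; first by rewrite lf => -> ->; rewrite mulr0 addr0.
  apply/eqP; rewrite -cabs_eq0 eq_le cabs_ge0 andbT; apply: le_eps => e e0.
  have [|N hN] := ul (e / (`|C| + 1)); first by rewrite divr_gt0 // ltr_wpDl.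
  have := hN N (leqnn _); rewrite ltr_pdivlMr ?ltr_wpDl // => h.
  have := hC (u N - l); rewrite fB hu sub0r /cabs normrN -/(cabs _) add0r => h1.
  rewrite (le_trans h1) // (le_trans _ (ltW h)) // mulrC ler_wpM2l ?rnorm_ge0 //.
  by rewrite (le_trans (ler_norm C)) // lerDl.
have [[x0 fx0]|] := pselect (exists x, f x <> 0); last first.
  move=> h; exists 0 => x; rewrite inner0r; apply: contrapT => h'; apply: h; by exists x.
have [p [Mp hp]] := projection x0 cM.
pose z := x0 - p; have fz : f z = f x0 by rewrite fB Mp subr0.
have z0 : '[z, z] != 0.
  by apply/eqP => /inner_eq0 z0; apply: fx0; rewrite -fz z0.
exists (Num.conj (f z / '[z, z]) *: z) => x.
have : '[z, f z *: x - f x *: z] = 0 by apply: hp => /=; rewrite fB !fZ mulrC subrr.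
rewrite innerBr !innerZr => /eqP; rewrite subr_eq0 => /eqP.
rewrite (innerC z x) -rmorphM => /(congr1 Num.conj).
rewrite !rmorphM /= !conjCK -!innerC => h.
by rewrite mulrAC h mulfK.
Qed.

(** Riesz gives the values; linearity follows from nondegeneracy of the form, the bound from |S x|^2
    = <T (S x), x>. *)
Lemma adjoint_exists T : BH T -> exists S, BH S /\ forall x y, '[T x, y] = '[x, S y].
Proof.
move=> hT; have [C C0 hC] := BH_bound hT.
have ex y : exists z, forall x, '[T x, y] = '[x, z].
  apply: riesz => [a x x'|]; first by rewrite (BH_linear hT) innerDl innerZl.
  exists (C * rnorm y) => x; apply: le_trans (cauchy_schwarz_inner _ _) _.
  by rewrite mulrAC ler_wpM2r ?rnorm_ge0.
have [S hS] := choice ex; exists S; split => [|x y]; last exact: hS.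
apply/BHP; split.
  move=> a x y; apply/eqP; rewrite -subr_eq0; apply/eqP/inner_eq0.
  set w := (X in '[X, _]).
  by rewrite innerBr innerDr innerZr -!hS innerDr innerZr subrr.
exists C => x.
have [s0|s0] := eqVneq (S x) 0; first by rewrite s0 rnorm0 mulr_ge0 ?rnorm_ge0.
have s1 := rnorm_gt0 s0.
rewrite -(ler_pM2r s1) -expr2 -rdotxx {1}/rdot -hS -/(rdot _ _).
rewrite (le_trans (cauchy_schwarz _ _)) // mulrAC ler_wpM2r ?rnorm_ge0 //.
Qed.

Lemma adjointP T : BH T ->
  BH (adjoint T) /\ forall x y, '[T x, y] = '[x, adjoint T y].
Proof.
move=> hT; rewrite /adjoint; case: xgetP => // h.
by have [S hS] := adjoint_exists hT; have := h S hS.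
Qed.

Lemma BH_adjoint T : BH T -> BH (adjoint T).
Proof. by case/adjointP. Qed.

Lemma adjointE T : BH T -> forall x y, '[T x, y] = '[x, adjoint T y].
Proof. by case/adjointP. Qed.

Lemma adjointE' T : BH T -> forall x y, '[x, T y] = '[adjoint T x, y].
Proof. by move=> hT x y; rewrite innerC (adjointE hT) -innerC. Qed.

Lemma adjoint_unique T S : BH T -> (forall x y, '[T x, y] = '[x, S y]) -> adjoint T = S.
Proof.
move=> hT hS; apply: funext => y; apply/eqP; rewrite -subr_eq0; apply/eqP/inner_eq0.
by rewrite innerBr -hS -(adjointE hT) subrr.
Qed.

Lemma adjointK T : BH T -> adjoint (adjoint T) = T.
Proof.
move=> hT; apply: adjoint_unique; first exact: BH_adjoint.
by move=> x y; rewrite -(adjointE' hT).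
Qed.

Lemma rdot_adjoint' T : BH T -> forall x y, rdot x (T y) = rdot (adjoint T x) y.
Proof. by move=> hT x y; rewrite /rdot (adjointE' hT). Qed.

Lemma opnorm_adjoint_le T : BH T -> opnorm (adjoint T) <= opnorm T.
Proof.
move=> hT; apply: opnorm_le => [|x]; first exact: opnorm_ge0.
set S := adjoint T.
have [s0|s0] := eqVneq (S x) 0; first by rewrite s0 rnorm0 mulr_ge0 ?rnorm_ge0 ?opnorm_ge0.
have s1 := rnorm_gt0 s0.
rewrite -(ler_pM2r s1) -expr2 -rdotxx {1}/rdot /S -(adjointE hT) -/(rdot _ _).
rewrite (le_trans (cauchy_schwarz _ _)) // mulrAC ler_wpM2r ?rnorm_ge0 //.
exact: opnormP.
Qed.

Lemma opnorm_adjoint T : BH T -> opnorm (adjoint T) = opnorm T.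
Proof.
move=> hT; apply/eqP; rewrite eq_le opnorm_adjoint_le //=.
by rewrite -{1}(adjointK hT) opnorm_adjoint_le //; exact: BH_adjoint.
Qed.

(* An operator that is bounded below has closed range; the range is dense as
   soon as the adjoint is injective. *)
Lemma inverse_exists T (c : R) : BH T -> 0 < c ->
    (forall x, c * rnorm x <= rnorm (T x)) ->
    (forall x, adjoint T x = 0 -> x = 0) ->
  exists S, [/\ BH S, forall x, S (T x) = x & forall x, T (S x) = x].
Proof.
move=> hT c0 hc hi.
have inj x : T x = 0 -> x = 0.
  move=> h; apply: rnorm_eq0; apply/eqP; rewrite eq_le rnorm_ge0 andbT.
  by have := hc x; rewrite h rnorm0 pmulr_rle0.
have cM : closed_subspace (range T).
  split=> /= [|a _ _ [x _ <-] [y _ <-]|u l hu ul].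
  - by exists 0 => //; rewrite (BH0 hT).
  - by exists (a *: x + y) => //; rewrite (BH_linear hT).
  - have [v hv] : exists v, forall n, T (v n) = u n.
      have /choice[v hv] : forall n, exists x, T x = u n.
        by move=> n; have [x _ hx] := hu n; exists x.
      by exists v.
    have cv (e : R) : 0 < e -> exists N, forall n, (N <= n)%N -> rnorm (v n - v N) < e.
      move=> e0; have e1 : 0 < c * e / 2 by rewrite divr_gt0 // mulr_gt0.
      have [N hN] := ul _ e1; exists N => n Nn.
      have := hc (v n - v N); rewrite (BHB hT) !hv => h.
      have := rnorm_dist l (u n) (u N); rewrite (rnormBC l).
      have := hN n Nn; have := hN N (leqnn N) => h1 h2 h3.
      rewrite -(ltr_pM2l c0); lra.
    have [w hw] := hilbert_complete cv.
    exists w => //; apply: scvg_unique (scvg_BH hT hw) _.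
    by move=> e e0; have [N hN] := ul e e0; exists N => n /hN; rewrite /= hv.
have surj y : exists x, T x = y.
  have [p [[x _ <-] hp]] := projection y cM.
  exists x; apply/eqP; rewrite eq_sym -subr_eq0; apply/eqP/hi/inner_eq0.
  by rewrite -(adjointE' hT) hp //; exists (adjoint T (y - T x)).
have [S hS] := choice surj.
have ST x : S (T x) = x.
  by apply/eqP; rewrite -subr_eq0; apply/eqP/inj; rewrite (BHB hT) hS subrr.
exists S; split=> //; apply/BHP; split.
  by move=> a x y; rewrite -{1}(hS x) -{1}(hS y) -(BH_linear hT) ST.
by exists c^-1 => x; rewrite -(ler_pM2l c0) mulVKf ?gt_eqF // -{2}(hS x).
Qed.

End Projection.
(** * Square roots and isometries *)

Section PositiveOperators.
Context {R : realType} {H : hilbertType R}.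
Implicit Types (x y z : H) (T S P : H -> H).

Definition selfadj P := forall x y, '[P x, y] = '[x, P y].

Lemma selfadj_rdot P : selfadj P -> forall x y, rdot (P x) y = rdot x (P y).
Proof. by move=> h x y; rewrite /rdot h. Qed.

Lemma selfadj_adjoint P : BH P -> selfadj P -> adjoint P = P.
Proof. by move=> hP sP; apply: adjoint_unique. Qed.

Lemma selfadj_shift P (c : R) : selfadj P -> selfadj (fun x => P x - c%:C *: x).
Proof. by move=> sP x y; rewrite innerBl innerBr innerZl innerZr sP conj_real. Qed.

Lemma selfadj_inverse P (c : R) : BH P -> selfadj P -> 0 < c ->
    (forall x, c * rnorm x <= rnorm (P x)) ->
  exists S, [/\ BH S, forall x, S (P x) = x & forall x, P (S x) = x].
Proof.
move=> hP sP c0 hc; apply: (inverse_exists hP c0 hc) => x.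
rewrite (selfadj_adjoint hP sP) => h; apply: rnorm_eq0; apply/eqP.
rewrite eq_le rnorm_ge0 andbT -(pmulr_rle0 _ c0).
by apply: (le_trans (hc x)); rewrite h rnorm0.
Qed.

Lemma selfadj_inner P x : selfadj P -> '[P x, x] = (rdot (P x) x)%:C.
Proof.
move=> h; rewrite /rdot RRe_real //; apply/Creal_ImP/eqP.
have : Num.conj '[P x, x] = '[P x, x] by rewrite -innerC h.
move=> /CrealP /Creal_ImP ->; exact: eqxx.
Qed.

(** Polarization: the form is real at x + y and at x + i y, which in turn compares the imaginary and
    the real parts of <P x, y> and <P y, x>. *)
Lemma positive_selfadj P : BH P -> positive_op P -> selfadj P.
Proof.
move=> hP pP x y.
have real z : Num.conj '[P z, z] = '[P z, z] by apply/CrealP/ger0_real/pP.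
have h1 := real (x + y).
have h2 := real (x + 'i%C *: y).
have i0 : ('i%C : R[i]) != 0 by rewrite eq_complex /= oner_eq0 andbF.
rewrite (innerC x); move: h1 h2.
rewrite !(BHD hP) (BHZ hP) !innerDl !innerDr !innerZl !innerZr conj_imaginary.
have hx := real x; have hy := real y.
move: hx hy; move: '[P x, x] '[P y, y] '[P x, y] '[P y, x] => p q a b hx hy.
rewrite !rmorphD !rmorphM !rmorphN /= conj_imaginary hx hy => h1 h2.
have e1 : Num.conj a + Num.conj b = a + b.
  have -> : Num.conj a + Num.conj b = p + Num.conj a + (Num.conj b + q) - p - q by ring.
  by rewrite h1; ring.
have e2 : 'i%C * (Num.conj a - Num.conj b) = 'i%C * (b - a).
  move: h2; set t := 'i%C * (- 'i%C * q) => h2.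
  have -> : 'i%C * (b - a) = p + - 'i%C * a + ('i%C * b + t) - p - t by ring.
  by rewrite -h2 /t; ring.
have e3 := mulfI i0 e2.
have : 2%:R * a = 2%:R * Num.conj b.
  have -> : 2%:R * a = (a + b) - (b - a) by ring.
  by rewrite -e1 -e3; ring.
by apply: mulfI; rewrite pnatr_eq0.
Qed.

(* Cauchy-Schwarz for the positive form <P x, y>, applied to y = P x. *)
Lemma positive_norm_le P (c : R) : BH P -> selfadj P ->
    (forall x, 0 <= rdot (P x) x) -> 0 <= c ->
    (forall x, rdot (P x) x <= c * rnorm x ^+ 2) ->
  forall x, rnorm (P x) ^+ 2 <= c * rdot (P x) x.
Proof.
move=> hP sP pP c0 hc x.
set y := P x; set q := rdot y x.
have h (t : R) : 2 * t * rnorm y ^+ 2 <= q + t ^+ 2 * (c * rnorm y ^+ 2).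
  have := pP (x - t%:C *: y); rewrite (BHB hP) (BHZ hP) -/y.
  rewrite !(rdotBl, rdotBr, rdotZl, rdotZr).
  rewrite (selfadj_rdot sP y x) -/y !rdotxx -/q => h1.
  have : 0 <= t ^+ 2 by rewrite sqr_ge0.
  have := hc y; nra.
have q0 : 0 <= q by exact: pP.
have y0 : 0 <= rnorm y ^+ 2 by rewrite exprn_ge0 ?rnorm_ge0.
have [cz|cz] := eqVneq c 0.
  rewrite cz in h *; rewrite mul0r.
  have [->//|yz] := eqVneq (rnorm y ^+ 2) 0.
  have := h (q / rnorm y ^+ 2 + 1).
  have -> : 2 * (q / rnorm y ^+ 2 + 1) * rnorm y ^+ 2 = 2 * q + 2 * rnorm y ^+ 2.
    by rewrite -mulrA [X in 2 * X]mulrDl divfK // mul1r mulrDr.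
  nra.
have cp : 0 < c by rewrite lt_neqAle eq_sym cz.
have := h c^-1.
have -> : c^-1 ^+ 2 * (c * rnorm y ^+ 2) = c^-1 * rnorm y ^+ 2 by field.
move=> h1; have h2 : c^-1 * rnorm y ^+ 2 <= q by lra.
by rewrite -ler_pdivrMl.
Qed.

Section SquareRoot.
Variables (T : H -> H) (hT : BH T).
(** Dividing by [k] makes B = 1 - A / k a contraction; the added 1 keeps [k] positive when T = 0. *)
Let k : R := opnorm T ^+ 2 + 1.
Let k0 : 0 < k. Proof. by rewrite ltr_wpDl // exprn_ge0 // opnorm_ge0. Qed.
Let A x := adjoint T (T x).
Let hA : BH A. Proof. exact: (BH_comp (BH_adjoint hT) hT). Qed.
Let B x := x - k^-1%:C *: A x.
Let hB : BH B. Proof. by apply: BH_sub; [exact: BH_id | exact: BH_scale]. Qed.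
Let sA : selfadj A.
Proof. by move=> x y; rewrite /A -(adjointE' hT) (adjointE hT). Qed.

Let sB : selfadj B.
Proof. by move=> x y; rewrite /B innerBl innerBr innerZl innerZr sA conj_real. Qed.

Let B1 x : rnorm (B x) <= rnorm x.
Proof.
apply: ler_sqr_nneg; rewrite ?rnorm_ge0 // rnormB2 rdotZr rnormZ cabsR.
rewrite (ger0_norm (_ : 0 <= k^-1)) ?invr_ge0 ?(ltW k0) // exprMn.
have e : rdot x (A x) = rnorm (T x) ^+ 2.
  by rewrite rdotC /A /rdot -(adjointE' hT) -/(rdot _ _) rdotxx.
rewrite e.
have h1 : rnorm (A x) ^+ 2 <= k * rnorm (T x) ^+ 2.
  have := opnormP (T x) (BH_adjoint hT); rewrite (opnorm_adjoint hT) -/(A x) => h.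
  have := rnorm_ge0 (A x); have := rnorm_ge0 (T x); have := opnorm_ge0 hT.
  have : rnorm (A x) ^+ 2 <= (opnorm T * rnorm (T x)) ^+ 2.
    by rewrite ler_pXn2r ?nnegrE ?rnorm_ge0 // mulr_ge0 ?rnorm_ge0 ?opnorm_ge0.
  by rewrite exprMn /k mulrDl mul1r => h2 _ _ _; apply: (le_trans h2); rewrite lerDl sqr_ge0.
have h2 : k^-1 ^+ 2 * rnorm (A x) ^+ 2 <= k^-1 * rnorm (T x) ^+ 2.
  rewrite expr2 -mulrA ler_pM2l ?invr_gt0 //.
  by rewrite mulrC ler_pdivrMr // mulrC.
have : 0 <= k^-1 * rnorm (T x) ^+ 2 by rewrite mulr_ge0 ?sqr_ge0 // invr_ge0 ltW.
lra.
Qed.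

(* Y = (B + Y^2) / 2 means (1 - Y)^2 = 1 - B = A / k; the scalar recursion
   [ys] started with B = 1 dominates all the norms involved. *)
Let Y : nat -> H -> H := fix Y n x :=
  if n is m.+1 then (2^-1 : R)%:C *: (B x + Y m (Y m x)) else 0.
Let ys : nat -> R := fix y n := if n is m.+1 then 2^-1 * (1 + y m ^+ 2) else 0.

Let hY n : BH (Y n).
Proof.
elim: n => [|n ih]; first exact: BH_cst0.
apply: (@BH_scale R H (2^-1 : R)%:C (fun x => B x + Y n (Y n x))).
exact: (BH_add hB (BH_comp ih ih)).
Qed.

Let sY n : selfadj (Y n).
Proof.
elim: n => [|n ih] x y /=; first by rewrite inner0l inner0r.
by rewrite innerZl innerZr conj_real innerDl innerDr sB !ih.
Qed.

(** Each [Y n] is a polynomial in [B]. The resulting commutation allows differences of squares to be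
    factored. *)
Let YC (C : H -> H) n : BH C -> (forall x, C (B x) = B (C x)) ->
  forall x, C (Y n x) = Y n (C x).
Proof.
move=> hC cB; elim: n => [|n ih] x /=; first exact: (BH0 hC).
by rewrite (BHZ hC) (BHD hC) cB !ih.
Qed.

Let YY n m x : Y n (Y m x) = Y m (Y n x).
Proof.
apply: YC => // z; rewrite -YC //.
Qed.

Let ys01 n : 0 <= ys n <= 1.
Proof. by elim: n => [|n /andP[h0 h1]] /=; [rewrite lexx ler01 | apply/andP; split; nra]. Qed.

Let ys_le n : ys n <= ys n.+1.
Proof.
elim: n => [|n ih]; first by have /andP[] := ys01 1.
rewrite /= -/(ys n.+1) -/(ys n) ler_pM2l ?invr_gt0 // lerD2l.
by have /andP[? _] := ys01 n; have /andP[? _] := ys01 n.+1; rewrite ler_pXn2r.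
Qed.

Let half_norm : cabs (2^-1 : R)%:C = 2^-1.
Proof. by rewrite cabsR ger0_norm ?invr_ge0. Qed.

Let Yn n x : rnorm (Y n x) <= ys n * rnorm x.
Proof.
elim: n x => [|n ih] x; first by rewrite /= rnorm0 mul0r.
rewrite /= rnormZ half_norm -mulrA ler_pM2l ?invr_gt0 //.
rewrite (le_trans (rnormD _ _)) // mulrDl mul1r lerD ?B1 // expr2 -mulrA.
by rewrite (le_trans (ih _)) // ler_wpM2l ?ih //; have /andP[] := ys01 n.
Qed.

(** Y (n+2) - Y (n+1) is half the product of Y (n+1) + Y n and Y (n+1) - Y n, and [ys] obeys the
    same identity, so domination propagates. *)
Let YS n x : rnorm (Y n.+1 x - Y n x) <= (ys n.+1 - ys n) * rnorm x.
Proof.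
elim: n x => [|n ih] x.
  by rewrite [Y 0 x]/= [ys 0]/= !subr0; exact: Yn.
have -> : Y n.+2 x - Y n.+1 x =
    (2^-1 : R)%:C *: (Y n.+1 (Y n.+1 x - Y n x) + Y n (Y n.+1 x - Y n x)).
  rewrite [Y n.+2 x]/= -/(Y n.+1) {3}[Y n.+1]/= -scalerBr; congr (_ *: _).
  rewrite !(BHB (hY _)) (YY n.+1 n) addrA subrK opprD addrACA subrr add0r.
  by rewrite -/(Y n.+1).
rewrite rnormZ half_norm.
have h := rnormD (Y n.+1 (Y n.+1 x - Y n x)) (Y n (Y n.+1 x - Y n x)).
have h1 := Yn n.+1 (Y n.+1 x - Y n x); have h2 := Yn n (Y n.+1 x - Y n x).
have -> : ys n.+2 - ys n.+1 = 2^-1 * ((ys n.+1 + ys n) * (ys n.+1 - ys n)).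
  have -> : ys n.+2 = 2^-1 * (1 + ys n.+1 ^+ 2) by [].
  rewrite {2}[ys n.+1]/= -/(ys n); ring.
rewrite -[leRHS]mulrA ler_pM2l ?invr_gt0 // -[leRHS]mulrA.
apply: (@le_trans _ _ ((ys n.+1 + ys n) * rnorm (Y n.+1 x - Y n x))).
  by rewrite mulrDl; lra.
by rewrite ler_wpM2l ?ih // addr_ge0 //; [have /andP[] := ys01 n.+1 | have /andP[] := ys01 n].
Qed.

Let Ydist n m x : (n <= m)%N -> rnorm (Y m x - Y n x) <= (ys m - ys n) * rnorm x.
Proof.
elim: m => [|m ih]; first by rewrite leqn0 => /eqP ->; rewrite !subrr rnorm0 mul0r.
rewrite leq_eqVlt => /predU1P[->|]; first by rewrite !subrr rnorm0 mul0r.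
rewrite ltnS => /ih h.
have := rnorm_dist (Y m x) (Y m.+1 x) (Y n x); have := YS m x.
rewrite !mulrBl in h *; lra.
Qed.

(** [ys] is increasing and bounded, and [Ydist] transfers its Cauchy property to the vectors Y n
    x. *)
Let Ylim x : exists l, scvg (Y^~ x) l.
Proof.
apply: hilbert_complete => e e0.
have hs : has_sup (range ys).
  by split; [exists (ys 0), 0 | exists 1 => _ [n _ <-]; have /andP[] := ys01 n].
have e1 : 0 < e / (rnorm x + 1) by rewrite divr_gt0 // ltr_wpDl ?rnorm_ge0.
have [_ [N _ <-] hN] := sup_adherent e1 hs.
exists N => n Nn; apply: le_lt_trans (Ydist x Nn) _.
have : ys n <= sup (range ys) by apply: ub_le_sup; [exact: hs.2 | exists n].
move=> h; have h1 : ys n - ys N < e / (rnorm x + 1) by lra.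
rewrite ltr_pdivlMr ?ltr_wpDl ?rnorm_ge0 // in h1.
apply: le_lt_trans h1; rewrite mulrDr lerDl mulr1 subr_ge0.
by elim: n Nn {h} => [|n ih]; [rewrite leqn0 => /eqP -> |
  rewrite leq_eqVlt => /predU1P[->//|]; rewrite ltnS => /ih/le_trans; apply; exact: ys_le].
Qed.

(** The pointwise limit [L] of [Y] solves L = (B + L^2) / 2, so sqrt k (1 - L) squares to [A]; it is
    positive because |L x| <= |x|. *)
Lemma sqrt_exists : exists P, [/\ BH P, positive_op P & P \o P = adjoint T \o T].
Proof.
have [L hL] := choice Ylim.
have L1 x : rnorm (L x) <= rnorm x.
  apply: scvg_norm (hL x) _ => n; apply: (le_trans (Yn _ _)).
  by rewrite ler_piMl ?rnorm_ge0 //; have /andP[] := ys01 n.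
have lL : linear L.
  move=> a x y; apply: scvg_unique (hL _) _.
  have -> : (fun n => Y n (a *: x + y)) = (fun n => a *: Y n x + Y n y).
    by apply: funext => n; rewrite (BH_linear (hY n)).
  by apply: scvg_add => //; exact: (scvg_BH (BH_scale a BH_id)).
have bL : BH L by apply/BHP; split => //; exists 1 => x; rewrite mul1r.
have sL : selfadj L.
  move=> x y; apply/eqP; rewrite -subr_eq0 -cabs_eq0 eq_le cabs_ge0 andbT.
  apply: le_eps => e e0.
  pose c := rnorm x + rnorm y + 1.
  have c0 : 0 < c by rewrite /c ltr_wpDl // addr_ge0 // rnorm_ge0.
  have e1 : 0 < e / c by rewrite divr_gt0.
  have [N hN] := hL x _ e1; have [N' hN'] := hL y _ e1.
  have := hN _ (leq_maxl N N'); have := hN' _ (leq_maxr N N').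
  set n := maxn N N' => h1 h2.
  have -> : '[L x, y] - '[x, L y] = '[L x - Y n x, y] - '[x, L y - Y n y].
    by rewrite innerBl innerBr sY; ring.
  rewrite add0r.
  have := cauchy_schwarz_inner (L x - Y n x) y.
  have := cauchy_schwarz_inner x (L y - Y n y).
  rewrite (rnormBC (L x)) (rnormBC (L y)) => h3 h4.
  have h5 : cabs ('[L x - Y n x, y] - '[x, L y - Y n y]) <=
      cabs '[L x - Y n x, y] + cabs '[x, L y - Y n y].
    by rewrite -lecR rmorphD /= -!norm_cabs ler_normB.
  have : e / c * (rnorm x + rnorm y) <= e.
    rewrite mulrAC ler_pdivrMr // ler_pM2l // /c lerDl ler01 //.
  have := rnorm_ge0 x; have := rnorm_ge0 y; nra.
have fL x : L x = (2^-1 : R)%:C *: (B x + L (L x)).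
  have h1 : scvg (fun n => Y n.+1 x) (L x).
    move=> e e0; have [N hN] := hL x e e0; exists N => n Nn; apply: hN; exact: leqW.
  apply: scvg_unique h1 _.
  apply: (@scvg_BH _ _ _ _ _ (BH_scale _ BH_id)).
  apply: scvg_add; first by move=> e e0; exists 0%N => n _; rewrite subrr rnorm0.
  (* Since [Y n] is a contraction, replacing the inner Y n x by L x costs at most |Y n x - L x|. *)
  move=> e e0; have e1 : 0 < e / 2 by rewrite divr_gt0.
  have [N hN] := hL x _ e1; have [N' hN'] := hL (L x) _ e1.
  exists (maxn N N') => n; rewrite geq_max => /andP[/hN h2 /hN' h3].
  have := rnorm_dist (Y n (L x)) (Y n (Y n x)) (L (L x)).
  rewrite -(BHB (hY n)); have := Yn n (Y n x - L x).
  have : ys n * rnorm (Y n x - L x) <= rnorm (Y n x - L x).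
    by rewrite ler_piMl ?rnorm_ge0 //; have /andP[] := ys01 n.
  lra.
have sk : Num.sqrt k ^+ 2 = k by rewrite sqr_sqrtr // ltW.
exists (fun x => (Num.sqrt k)%:C *: (x - L x)); split.
- by apply: BH_scale; apply: BH_sub => //; exact: BH_id.
- move=> x; rewrite innerZl innerBl (selfadj_inner _ sL) inner_rnorm -rmorphB -rmorphM /=.
  rewrite (ler0c) mulr_ge0 ?sqrtr_ge0 // subr_ge0.
  apply: (le_trans (cauchy_schwarz _ _)); rewrite expr2 ler_wpM2r ?rnorm_ge0 //.
- apply: funext => x /=.
  rewrite (BHZ bL) (BHB bL) -scalerBr scalerA -rmorphM -expr2 sk.
  have -> : L (L x) = 2%:R *: L x - B x.
    rewrite {2}(fL x) scalerA.
    have -> : 2%:R * (2^-1 : R)%:C = 1 :> R[i].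
      by rewrite -(rmorph_nat (real_complex R)) -rmorphM /= divff // pnatr_eq0.
    by rewrite scale1r addrC addKr.
  have -> : x - L x - (L x - (2%:R *: L x - B x)) = k^-1%:C *: A x.
    rewrite scaler_nat mulr2n opprB.
    have -> : L x + L x - B x - L x = L x - B x by rewrite addrAC addrK.
    by rewrite addrA subrK /B subKr.
  by rewrite scalerA -rmorphM divff ?gt_eqF // scale1r.
Qed.

End SquareRoot.

Lemma absopP T : BH T ->
  [/\ BH (absop T), selfadj (absop T), forall x, 0 <= rdot (absop T x) x &
      forall x y, '[absop T x, absop T y] = '[T x, T y]].
Proof.
move=> hT; rewrite /absop; case: xgetP => [P _|h]; last first.
  by have [P hP] := sqrt_exists hT; have := h P hP.
move=> [hP pP eP]; have sP := positive_selfadj hP pP; split=> // [x|x y].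
  by have := pP x; rewrite (selfadj_inner _ sP) ler0c.
by rewrite -sP (adjointE' hT) -[RHS]/('[(adjoint T \o T) x, y]) -eP.
Qed.

Lemma absop_norm T x : BH T -> rnorm (absop T x) = rnorm (T x).
Proof.
move=> hT; have [_ _ _ h] := absopP hT.
by apply: eqr_sqr_nneg; rewrite ?rnorm_ge0 // -!rdotxx /rdot h.
Qed.

End PositiveOperators.

(** * Isometries and unitaries determined by generators *)

Section IsometryExtension.
Context {R : realType} {H : hilbertType R}.
Implicit Types (x y z u v : H) (V : H -> H) (g : H -> H -> Prop).

(** The span of the graph [g] is kept as a relation: that it is single-valued only follows from the
    comparison of inner products. *)
Inductive lspan g : H -> H -> Prop :=
| lspan0 : lspan g 0 0
| lspanS a x y u v : g x y -> lspan g u v -> lspan g (a *: x + u) (a *: y + v).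

Lemma lspan_gen g x y : g x y -> lspan g x y.
Proof.
move=> h; have := lspanS 1 h (lspan0 g).
by rewrite !scale1r !addr0.
Qed.

Lemma lspan_lin g b u v u' v' : lspan g u v -> lspan g u' v' ->
  lspan g (b *: u + u') (b *: v + v').
Proof.
move=> h h'; elim: h => [|a x y {}u {}v gxy _ ih]; first by rewrite !scaler0 !add0r.
by rewrite !scalerDr !scalerA -!addrA; exact: lspanS.
Qed.

Lemma lspan_inner g : (forall x y x' y', g x y -> g x' y' -> '[x, x'] = '[y, y']) ->
  forall u v u' v', lspan g u v -> lspan g u' v' -> '[u, u'] = '[v, v'].
Proof.
move=> hg u v u' v' h; elim: h u' v' => [|a x y {}u {}v gxy _ ih] u' v' h'.
  by rewrite !inner0l.
rewrite !innerDl !innerZl (ih _ _ h'); congr (_ * _ + _).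
elim: h' => [|b x' y' {}u' {}v' gxy' _ ih']; first by rewrite !inner0r.
by rewrite !innerDr !innerZr ih' (hg _ _ _ _ gxy gxy').
Qed.

Lemma isometry_inner V : BH V -> (forall x, rnorm (V x) = rnorm x) ->
  forall x y, '[V x, V y] = '[x, y].
Proof.
move=> hV iV.
have h x y : rdot (V x) (V y) = rdot x y.
  have := rnormD2 (V x) (V y); rewrite -(BHD hV) !iV rnormD2; lra.
by move=> x y; rewrite inner_rdot [RHS]inner_rdot -(BHZ hV) !h.
Qed.

(** [dg] makes the domain of the span dense. The closure [G] of the span preserves norms, hence is
    single-valued; it is total by completeness, so it is the graph of [V]. *)
Lemma isometry_extension g :
    (forall x y x' y', g x y -> g x' y' -> '[x, x'] = '[y, y']) ->
    (forall z, (forall x y, g x y -> '[z, x] = 0) -> z = 0) ->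
  exists V, [/\ BH V, forall x y, '[V x, V y] = '[x, y] & forall x y, g x y -> V x = y].
Proof.
move=> hg dg.
pose D z := forall e : R, 0 < e -> exists u v, lspan g u v /\ rnorm (u - z) < e.
have cD : closed_subspace D.
  split.
  - by move=> e e0; exists 0, 0; rewrite subrr rnorm0; split => //; exact: lspan0.
  - move=> a x y hx hy e e0.
    have ca : 0 < cabs a + 1 by rewrite ltr_wpDl // cabs_ge0.
    have [|u [v [s hu]]] := hx (e / 2 / (cabs a + 1)); first by rewrite !divr_gt0.
    have [|u' [v' [s' hu']]] := hy (e / 2); first by rewrite divr_gt0.
    exists (a *: u + u'), (a *: v + v'); split; first exact: lspan_lin.
    rewrite opprD addrACA -scalerBr; apply: (le_lt_trans (rnormD _ _)).
    rewrite rnormZ; rewrite ltr_pdivlMr // in hu.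
    by have := rnorm_ge0 (u - x); have := cabs_ge0 a; nra.
  - move=> w l hw wl e e0; have e2 : 0 < e / 2 by rewrite divr_gt0.
    have [N hN] := wl _ e2; have [u [v [s hu]]] := hw N _ e2.
    exists u, v; split => //; have := hN N (leqnn _).
    have := rnorm_dist (w N) u l; lra.
have DT z : D z.
  have [p [Dp hp]] := projection z cD.
  suff /eqP : z - p = 0 by rewrite subr_eq0 => /eqP ->.
  apply: dg => x y gxy; apply: hp => e e0; exists x, y.
  by rewrite subrr rnorm0; split => //; exact: lspan_gen.
have nlspan u v : lspan g u v -> rnorm u = rnorm v.
  move=> h; apply: eqr_sqr_nneg; rewrite ?rnorm_ge0 // -!rdotxx /rdot.
  by rewrite (lspan_inner hg h h).
pose G z w := exists u v : nat -> H,
  [/\ forall n, lspan g (u n) (v n), scvg u z & scvg v w].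
have GT z : exists w, G z w.
  have : forall n : nat, exists uv : H * H,
      lspan g uv.1 uv.2 /\ rnorm (uv.1 - z) < n.+1%:R^-1.
    by move=> n; have [|u [v h]] := DT z n.+1%:R^-1; [rewrite invr_gt0 | exists (u, v)].
  move=> /choice[w hw].
  pose u n := (w n).1; pose v n := (w n).2.
  have uz : scvg u z.
    move=> e e0; have [N hN] := ex_invn_lt e0; exists N => n Nn.
    apply: lt_trans (hw n).2 _; apply: le_lt_trans hN.
    by rewrite lef_pV2 ?posrE ?ltr0Sn // ler_nat ltnS.
  have [l hl] : exists l, scvg v l.
    apply: hilbert_complete => e e0; have e2 : 0 < e / 2 by rewrite divr_gt0.
    have [N hN] := uz _ e2; exists N => n Nn.
    have -> : rnorm (v n - v N) = rnorm (u n - u N).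
      rewrite (_ : v n - v N = (-1) *: v N + v n); last by rewrite scaleN1r addrC.
      rewrite (_ : u n - u N = (-1) *: u N + u n); last by rewrite scaleN1r addrC.
      apply/esym/nlspan.
      exact: (lspan_lin _ (hw N).1 (hw n).1).
    have := rnorm_dist z (u n) (u N); rewrite (rnormBC z).
    have := hN n Nn; have := hN N (leqnn _); lra.
  by exists l, u, v; split => // n; exact: (hw n).1.
have GL a x y x' y' : G x y -> G x' y' -> G (a *: x + x') (a *: y + y').
  move=> [u [v [s uz vz]]] [u' [v' [s' uz' vz']]].
  exists (fun n => a *: u n + u' n), (fun n => a *: v n + v' n); split.
  - by move=> n; exact: lspan_lin.
  - by apply: scvg_add => //; exact: (scvg_BH (BH_scale a BH_id)).
  - by apply: scvg_add => //; exact: (scvg_BH (BH_scale a BH_id)).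
have GN x y : G x y -> rnorm y = rnorm x.
  move=> [u [v [s uz vz]]]; apply/eqP; rewrite eq_le; apply/andP; split.
    apply: le_eps => e e0; have e2 : 0 < e / 2 by rewrite divr_gt0.
    have [N hN] := uz _ e2; have [N' hN'] := vz _ e2.
    have := hN _ (leq_maxl N N'); have := hN' _ (leq_maxr N N').
    have := nlspan _ _ (s (maxn N N')).
    have := rnorm_lerB y (v (maxn N N')); have := rnorm_lerB (u (maxn N N')) x.
    rewrite (rnormBC y); lra.
  apply: le_eps => e e0; have e2 : 0 < e / 2 by rewrite divr_gt0.
  have [N hN] := uz _ e2; have [N' hN'] := vz _ e2.
  have := hN _ (leq_maxl N N'); have := hN' _ (leq_maxr N N').
  have := nlspan _ _ (s (maxn N N')).
  have := rnorm_lerB (v (maxn N N')) y; have := rnorm_lerB x (u (maxn N N')).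
  rewrite (rnormBC x); lra.
have Gu x y y' : G x y -> G x y' -> y = y'.
  move=> h h'; apply/eqP; rewrite eq_sym -subr_eq0; apply/eqP/rnorm_eq0.
  have := GN _ _ (GL (-1) _ _ _ _ h h').
  by rewrite !scaleN1r addNr rnorm0 addrC.
have [V hV] := choice GT.
have bV : BH V.
  apply/BHP; split; last by exists 1 => x; rewrite mul1r (GN _ _ (hV x)).
  by move=> a x y; apply: Gu (hV _) _; exact: GL.
exists V; split => //; first by apply: isometry_inner => // x; exact/GN/hV.
move=> x y gxy; apply: Gu (hV x) _.
by exists (fun=> x), (fun=> y); split => [_||]; [exact: lspan_gen |
  move=> e e0; exists 0%N => n _; rewrite subrr rnorm0 ..].
Qed.

(** An isometry satisfies V^* V = 1, so V^* kills y - V (V^* y), which is therefore orthogonal to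
    the range; the third hypothesis makes it zero. *)
Lemma unitary_extension g :
    (forall x y x' y', g x y -> g x' y' -> '[x, x'] = '[y, y']) ->
    (forall z, (forall x y, g x y -> '[z, x] = 0) -> z = 0) ->
    (forall z, (forall x y, g x y -> '[z, y] = 0) -> z = 0) ->
  exists2 V, unitary V & forall x y, g x y -> V x = y.
Proof.
move=> hg dg rg; have [V [hV iV gV]] := isometry_extension hg dg.
have aV x : adjoint V (V x) = x.
  apply/eqP; rewrite -subr_eq0; apply/eqP/inner_eq0.
  set w := (X in '[_, X]).
  by rewrite innerBl -(adjointE' hV) iV subrr.
exists V => //; split => //; apply: funext => y //=.
apply/eqP; rewrite eq_sym -subr_eq0; apply/eqP/rg => x z /gV <-.
by rewrite (adjointE' hV) (BHB (BH_adjoint hV)) aV subrr inner0l.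
Qed.

Lemma unitaryP (U : H -> H) : unitary U ->
  [/\ BH U, forall x y, '[U x, U y] = '[x, y], forall x, adjoint U (U x) = x,
      forall x, U (adjoint U x) = x & forall x, rnorm (U x) = rnorm x].
Proof.
move=> [hU /(congr1 (fun f => f _)) h1 /(congr1 (fun f => f _)) h2].
have aU x : adjoint U (U x) = x by exact: h2.
have iU x y : '[U x, U y] = '[x, y] by rewrite (adjointE hU) aU.
split => // x.
by apply: eqr_sqr_nneg; rewrite ?rnorm_ge0 // -!rdotxx /rdot iU.
Qed.

End IsometryExtension.
(** * Finite rank operators and the essential spectrum *)

Section FiniteRank.
Context {R : realType} {H : hilbertType R}.
Implicit Types (x y z u v : H) (T S P K : H -> H) (F G : seq H).

Definition orthol F x := forall v, v \in F -> '[x, v] = 0.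

Definition onlist F := uniq F /\ (forall u v, u \in F -> v \in F -> '[u, v] = (u == v)%:R).

Definition oproj F x : H := \sum_(v <- F) '[x, v] *: v.

Lemma orthol_cat F G x : orthol (F ++ G) x -> orthol F x /\ orthol G x.
Proof. by move=> h; split=> v vF; apply: h; rewrite mem_cat vF ?orbT. Qed.

Lemma BH_oproj F : BH (oproj F).
Proof. by apply: BH_bigsum => v; exact: BH_rank1. Qed.

Lemma oproj_selfadj F : selfadj (oproj F).
Proof.
move=> x y; rewrite /oproj inner_suml inner_sumr; apply: eq_bigr => v _.
by rewrite innerZl innerZr -innerC mulrC.
Qed.

Lemma oproj_inner F x v : onlist F -> v \in F -> '[oproj F x, v] = '[x, v].
Proof.
move=> [uF oF] vF; rewrite /oproj inner_suml (bigD1_seq v) //= innerZl (oF v v) // eqxx mulr1.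
rewrite big_seq_cond big1 ?addr0 // => w /andP[wF /negbTE wv].
by rewrite innerZl (oF w v) // wv mulr0.
Qed.

Lemma oproj_ortho F x : onlist F -> orthol F (x - oproj F x).
Proof. by move=> oF v vF; rewrite innerBl oproj_inner // subrr. Qed.

Lemma oproj_eq0 F x : orthol F x -> oproj F x = 0.
Proof.
by move=> h; rewrite /oproj big_seq big1 // => v vF; rewrite h ?scale0r.
Qed.

Lemma orthol_oproj F x y : orthol F x -> '[x, oproj F y] = 0.
Proof. by move=> h; rewrite -oproj_selfadj oproj_eq0 // inner0l. Qed.

Lemma oproj_id F x : onlist F -> oproj F (oproj F x) = oproj F x.
Proof.
move=> oF; apply/eqP; rewrite eq_sym -subr_eq0 -(BHB (BH_oproj F)).
by rewrite oproj_eq0 //; exact: oproj_ortho.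
Qed.

Lemma oproj_pythagoras F x : onlist F ->
  rnorm x ^+ 2 = rnorm (x - oproj F x) ^+ 2 + rnorm (oproj F x) ^+ 2.
Proof.
move=> oF; rewrite -pythagoras ?subrK //.
exact/orthol_oproj/oproj_ortho.
Qed.

(** Turns finitely many orthogonality constraints into an orthonormal list, for which [oproj] is a
    projection. Dependent vectors are dropped. *)
Lemma gram_schmidt F : exists2 G, onlist G & forall x, orthol G x -> orthol F x.
Proof.
elim: F => [|v F [G oG hG]]; first by exists [::].
pose w := v - oproj G v.
have wG : orthol G w := oproj_ortho v oG.
have vw x : orthol G x -> '[x, v] = '[x, w].
  by move=> xG; rewrite /w innerBr orthol_oproj // subr0.
have [w0|w0] := eqVneq w 0.
  exists G => // x xG u; rewrite inE => /predU1P[->|]; last exact: hG.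
  by rewrite vw // w0 inner0r.
have nw := rnorm_gt0 w0.
pose e := (rnorm w)^-1%:C *: w.
have ee : '[e, e] = 1.
  rewrite inner_rnorm /e rnormZ cabsR ger0_norm ?invr_ge0 ?rnorm_ge0 //.
  by rewrite mulVf ?gt_eqF // expr1n.
have eG : orthol G e by move=> u uG; rewrite /e innerZl wG // mulr0.
have eG' : e \notin G.
  apply/negP => /eG; rewrite ee => /eqP; by rewrite oner_eq0.
exists (e :: G).
  split; first by rewrite /= eG' oG.1.
  move=> x y; rewrite !inE => /predU1P[->|xG] /predU1P[->|yG].
  - by rewrite eqxx ee.
  - by rewrite eG //; case: eqP => // ey; rewrite ey yG in eG'.
  - by rewrite innerC eG // rmorph0; case: eqP => // ey; rewrite -ey xG in eG'.
  - exact: oG.2.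
move=> x xeG.
have xG : orthol G x by move=> u uG; apply: xeG; rewrite inE uG orbT.
move=> u; rewrite inE => /predU1P[->|]; last exact: hG.
rewrite vw //; have := xeG e; rewrite inE eqxx => /(_ isT).
rewrite /e innerZr => /eqP; rewrite mulf_eq0 conjC_eq0 fmorph_eq0 invr_eq0.
by rewrite gt_eqF //= => /eqP.
Qed.

Lemma unit_scale F T (c : R) : BH T ->
    (forall x, rnorm x = 1 -> orthol F x -> c <= rnorm (T x)) ->
  forall x, orthol F x -> c * rnorm x <= rnorm (T x).
Proof.
move=> hT h x xF; have [->|x0] := eqVneq x 0; first by rewrite rnorm0 mulr0 rnorm_ge0.
have x1 := rnorm_gt0 x0.
have := h ((rnorm x)^-1%:C *: x).
rewrite (BHZ hT) !rnormZ cabsR ger0_norm ?invr_ge0 ?rnorm_ge0 // mulVf ?gt_eqF //.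
move=> h1; rewrite -ler_pdivlMr // [leRHS]mulrC; apply: h1 => // v vF.
by rewrite innerZl xF // mulr0.
Qed.

Definition finrank K := exists s : seq (H * H), forall x, K x = \sum_(p <- s) '[x, p.1] *: p.2.

Lemma finrank_ext K K' : (forall x, K x = K' x) -> finrank K -> finrank K'.
Proof. by move=> h [s hs]; exists s => x; rewrite -h. Qed.

Lemma BH_finrank K : finrank K -> BH K.
Proof.
move=> [s hs]; have -> : K = (fun x => \sum_(p <- s) '[x, p.1] *: p.2) by exact: funext.
by apply: BH_bigsum => p; exact: BH_rank1.
Qed.

Lemma finrank_add K K' : finrank K -> finrank K' -> finrank (fun x => K x + K' x).
Proof. by move=> [s hs] [s' hs']; exists (s ++ s') => x; rewrite big_cat hs hs'. Qed.

Lemma finrank_compl T K : BH T -> finrank K -> finrank (fun x => T (K x)).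
Proof.
move=> hT [s hs]; exists [seq (p.1, T p.2) | p <- s] => x.
by rewrite big_map hs (BH_sum hT); apply: eq_bigr => p _; rewrite (BHZ hT).
Qed.

Lemma finrank_compr T K : BH T -> finrank K -> finrank (fun x => K (T x)).
Proof.
move=> hT [s hs]; exists [seq (adjoint T p.1, p.2) | p <- s] => x.
by rewrite big_map hs; apply: eq_bigr => p _; rewrite (adjointE hT).
Qed.

Lemma finrank_opp K : finrank K -> finrank (fun x => - K x).
Proof. by move=> hK; exact: (finrank_compl (BH_opp BH_id) hK). Qed.

Lemma finrank_sub K K' : finrank K -> finrank K' -> finrank (fun x => K x - K' x).
Proof. by move=> hK hK'; exact: finrank_add hK (finrank_opp hK'). Qed.

Lemma finrank_oproj F : finrank (oproj F).
Proof. by exists [seq (v, v) | v <- F] => x; rewrite big_map. Qed.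

(* x = y + K x is solved through the finite linear system satisfied by the
   coefficients of K x. *)
Lemma fredholm K : finrank K -> (forall x, K x = x -> x = 0) ->
  forall y, exists x, x - K x = y.
Proof.
move=> [s hs] inj y.
pose n := size s; pose u (i : 'I_n) := (nth (0, 0) s i).1.
pose v (i : 'I_n) := (nth (0, 0) s i).2.
have hK x : K x = \sum_(i < n) '[x, u i] *: v i.
  by rewrite hs (big_nth (0, 0)) big_mkord.
pose M : 'M[R[i]]_n := \matrix_(i, j) '[v i, u j].
pose comb (c : 'rV[R[i]]_n) := \sum_(i < n) c 0 i *: v i.
have comb_inner c j : '[comb c, u j] = (c *m M) 0 j.
  by rewrite /comb inner_suml !mxE; apply: eq_bigr => i _; rewrite innerZl mxE.
(* A left null vector [c] of 1 - M yields the fixed vector [comb c] of [K], which vanishes; then c =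
   c M = 0. *)
have unitM : 1%:M - M \in unitmx.
  rewrite -row_free_unit; apply/inj_row_free => c.
  rewrite mulmxBr mulmx1 => /eqP; rewrite subr_eq0 => /eqP cM.
  have c0 : comb c = 0.
    by apply: inj; rewrite hK; apply: eq_bigr => i _; rewrite comb_inner -cM.
  by apply/rowP => j; rewrite mxE cM -comb_inner c0 inner0l.
pose b := \row_j '[y, u j].
pose c := b *m invmx (1%:M - M).
have hc : c = b + c *m M.
  have : c *m (1%:M - M) = b by rewrite mulmxKV.
  by rewrite mulmxBr mulmx1 => <-; rewrite subrK.
exists (y + comb c); rewrite hK.
have -> : \sum_(i < n) '[y + comb c, u i] *: v i = comb c; last by rewrite addrK.
apply: eq_bigr => i _; congr (_ *: _).
by rewrite innerDl comb_inner [in RHS]hc !mxE.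
Qed.

Lemma continuous_real_scale v : continuous (fun a : R => a%:C *: v).
Proof.
move=> a; apply/cvgrPdist_lt => e e0.
have e1 : 0 < complex.Re e by move: e0; rewrite ltcE => /andP[].
have eE : e = (complex.Re e)%:C by rewrite RRe_real // gtr0_real.
have d0 : 0 < complex.Re e / (rnorm v + 1) by rewrite divr_gt0 // ltr_wpDl ?rnorm_ge0.
near=> b.
have : `|a - b| < complex.Re e / (rnorm v + 1).
  by near: b; apply: cvgr_dist_lt.
rewrite ltr_pdivlMr ?ltr_wpDl ?rnorm_ge0 // => h.
rewrite -scalerBl -rmorphB norm_rnorm eE ltcR rnormZ cabsR.
by apply: le_lt_trans h; rewrite ler_wpM2l // lerDl.
Unshelve. all: by end_near. Qed.

(** A compact set of real combinations. They reach complex coefficients once each vector is listed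
    along with its multiple by i, as in [finrank_KH]. *)
Fixpoint box (M : R) (s : seq H) : set H :=
  if s is v :: s' then
    (fun t : R * H => t.1%:C *: v + t.2) @` ([set a | - M <= a <= M] `*` box M s')
  else [set 0].

Lemma box_compact M s : compact (box M s).
Proof.
elim: s => [|v s ih] /=; first exact: compact_set1.
apply: continuous_compact.
  apply: continuous_subspaceT => t; apply: cvgD; last exact: cvg_snd.
  apply: (@cvg_comp _ _ _ fst (fun a : R => a%:C *: v)); last exact: continuous_real_scale.
  exact: cvg_fst.
apply: compact_setX => //.
have -> : [set a | - M <= a <= M] = `[- M, M]%classic by apply/seteqP; split=> a /=; rewrite in_itv.
exact: segment_compact.
Qed.

Lemma finrank_KH K : finrank K -> KH K.
Proof.
move=> hK; split; first exact: BH_finrank.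
case: hK => s hs.
pose M := \sum_(p <- s) rnorm p.1.
pose vs := flatten [seq [:: p.2; 'i%C *: p.2] | p <- s].
apply: (@precompact_subset _ _ (box M vs)); last first.
  by apply: compact_precompact; [exact: norm_hausdorff | exact: box_compact].
move=> _ [x x1 <-]; rewrite hs.
have hM p : p \in s -> rnorm p.1 <= M.
  move=> ps; rewrite /M (perm_big _ (perm_to_rem ps)) big_cons lerDl.
  by apply: sumr_ge0 => q _; exact: rnorm_ge0.
suff h N : (forall p, p \in s -> rnorm p.1 <= N) ->
    box N vs (\sum_(p <- s) '[x, p.1] *: p.2) by exact: h.
rewrite /vs; elim: s {hs vs M hM} => [|p s ih] hN; first by rewrite big_nil.
rewrite big_cons /=.
have ca : cabs '[x, p.1] <= N.
  apply: (le_trans (cauchy_schwarz_inner _ _)).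
  apply: (@le_trans _ _ (rnorm p.1)); last by apply: hN; rewrite inE eqxx.
  by rewrite ler_piMl ?rnorm_ge0.
have bRe (z : R[i]) : cabs z <= N -> - N <= complex.Re z <= N.
  move=> h; rewrite (le_trans (Re_le_cabs _) h) andbT lerNl.
  have -> : - complex.Re z = complex.Re (- z) by case: z {h}.
  by apply: (le_trans (Re_le_cabs _)); rewrite /cabs normrN.
have bIm (z : R[i]) : cabs z <= N -> - N <= complex.Im z <= N.
  move=> h; have -> : complex.Im z = complex.Re (- 'i%C * z).
    by case: z {h} => a b /=; rewrite !(oppr0, mul0r, mulN1r, opprK, sub0r).
  apply: bRe; rewrite cabsM /cabs normrN.
  suff -> : `|'i%C : R[i]| = 1 by rewrite mul1r.
  by rewrite normc_def /= expr0n /= expr1n add0r sqrtr1.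
exists (complex.Re '[x, p.1], (complex.Im '[x, p.1])%:C *: ('i%C *: p.2) +
  \sum_(q <- s) '[x, q.1] *: q.2) => /=; last first.
  rewrite addrA scalerA -scalerDl; congr (_ *: _ + _).
  by rewrite mulrC -complexE.
split; first exact: bRe.
exists (complex.Im '[x, p.1], \sum_(q <- s) '[x, q.1] *: q.2) => //=.
split; first exact: bIm.
by apply: ih => q qs; apply: hN; rewrite inE qs orbT.
Qed.

Lemma precompact_net (A : set H) (e : R) : precompact A -> 0 < e ->
  exists s : seq H, forall x, A x -> exists2 y, y \in s & rnorm (x - y) < e.
Proof.
rewrite precompactE compact_cover => cA e0.
have e1 : 0 < e%:C by rewrite (ltcR 0).
have [||D _ hD] := cA H setT (fun y => (ball y e%:C)%classic).
- by move=> y _; exact: ball_open.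
- by move=> x _; exists x => //; exact: ballxx.
exists (finmap.enum_fset D) => x Ax; have [y yD] := hD x (subset_closure Ax).
rewrite -ball_normE /= norm_rnorm ltcR rnormBC => h; by exists y.
Qed.

End FiniteRank.

(** * Weyl vectors and the max-min formula for the essential minimum modulus *)

Section EssentialSpectrum.
Context {R : realType} {H : hilbertType R}.
Implicit Types (x y z u v : H) (T S P K : H -> H) (F G : seq H).

(** Finite constraints replace the singular sequences of Weyl's criterion. For self-adjoint [P] the
    next two lemmas identify this property with membership of the real [l] in the essential
    spectrum. *)
Definition weyl P (l : R) := forall (e : R) F, 0 < e ->
  exists x, [/\ rnorm x = 1, orthol F x & rnorm (P x - l%:C *: x) < e].

(** Suppose S (P - l) = 1 + K with K compact. A unit vector [x] orthogonal to the images, under the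
    adjoint of K, of a finite net of K (ball) has small K x; if S (P - l) x is small too, |x| = 1
    fails. *)
Lemma weyl_ess_spectrum P l : BH P -> weyl P l -> ess_spectrum P l%:C.
Proof.
move=> hP hW [S [hS _ [bK cK]]].
set K := _ \- _ in bK cK.
have [C C0 hC] := BH_bound hS.
have e4 : 0 < 4^-1 :> R by rewrite invr_gt0.
have [s hs] := precompact_net cK e4.
have C1 : 0 < C + 1 by lra.
have [|x [x1 xF hx]] := hW (4^-1 / (C + 1)) [seq adjoint K y | y <- s]; first by rewrite divr_gt0.
have [|y ys hy] := hs (K x); first by exists x => //=; rewrite x1.
have oxy : '[K x, y] = 0.
  by rewrite (adjointE bK) xF //; apply/mapP; exists y.
have hK : rnorm (K x) < 4^-1.
  apply: le_lt_trans hy; apply: ler_sqr_nneg; rewrite ?rnorm_ge0 //.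
  by rewrite rnormB2 rdot_inner // mulr0 subr0 lerDl sqr_ge0.
have hSD : rnorm (S (P x - l%:C *: x)) <= 4^-1.
  apply: (le_trans (hC _)); rewrite ltr_pdivlMr // in hx.
  have := rnorm_ge0 (P x - l%:C *: x); nra.
have := rnorm_lerB x (S (P x - l%:C *: x)).
have {}hK : rnorm (S (P x - l%:C *: x) - x) < 4^-1 by exact: hK.
rewrite (rnormBC x) x1; lra.
Qed.

(** If D = P - l is bounded below on the complement of [F], adding to D^2 a finite rank projection
    [E] makes it invertible; with [N] the inverse, N D inverts [D] up to finite rank. *)
Lemma ess_spectrum_weyl P l : BH P -> selfadj P -> ess_spectrum P l%:C -> weyl P l.
Proof.
move=> hP sP; apply: contra_notP => /existsNP[e] /existsNP[F].
move=> /not_implyP[e0 /forallNP hF].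
pose D x := P x - l%:C *: x.
have bD : BH D by apply: BH_sub => //; exact: (BH_scale _ BH_id).
have sD : selfadj D by exact: selfadj_shift.
have [G oG GF] := gram_schmidt F.
pose E := oproj G.
have hE x : orthol G x -> e * rnorm x <= rnorm (D x).
  apply: unit_scale => // {}x x1 /GF xF; rewrite leNgt; apply/negP => h.
  by apply: (hF x).
have [M M0 hM] := BH_bound bD.
(* Splitting [x] into x - E x and E x gives |x| <= (|D x| + M |E x|) / e + |E x|. *)
pose k := e^-1 + M / e + 1.
have k0 : 0 < k by rewrite /k addr_gt0 // ltr_wpDr ?invr_gt0 // divr_ge0 // ltW.
have kx x : rnorm x <= k * (rnorm (D x) + rnorm (E x)).
  have h1 := hE _ (oproj_ortho x oG).
  have h2 : rnorm (D (x - E x)) <= rnorm (D x) + M * rnorm (E x).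
    by rewrite (BHB bD) (le_trans (rnormB _ _)) // lerD2l.
  have h3 : rnorm (x - E x) <= e^-1 * (rnorm (D x) + M * rnorm (E x)).
    by rewrite ler_pdivlMl //; apply: le_trans h1 h2.
  have := rnorm_dist 0 (x - E x) (- E x); rewrite subr0 sub0r !opprK subrK => h4.
  apply: (le_trans h4); apply: (le_trans (lerD h3 (lexx _))).
  rewrite /k mulrDr [leRHS]mulrDr [e^-1 * (M * _)]mulrA [e^-1 * M]mulrC.
  have := rnorm_ge0 (D x); have := rnorm_ge0 (E x).
  have : 0 <= M / e by rewrite divr_ge0 // ltW.
  have : 0 < e^-1 by rewrite invr_gt0.
  move: (M / e) (e^-1) => a b; nra.
pose B x := D (D x) + E x.
have bB : BH B by apply: BH_add; [exact: BH_comp | exact: BH_oproj].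
have sB : selfadj B.
  by move=> x y; rewrite /B innerDl innerDr !sD oproj_selfadj.
have qB x : rdot (B x) x = rnorm (D x) ^+ 2 + rnorm (E x) ^+ 2.
  rewrite /B rdotDl (selfadj_rdot sD) rdotxx; congr (_ + _).
  by rewrite -rdotxx /E [RHS](selfadj_rdot (@oproj_selfadj _ _ G)) oproj_id // rdotC.
(* Since (a + b)^2 <= 2 (a^2 + b^2), [kx] gives |x|^2 <= 2 k^2 <B x, x>. *)
pose c := (2 * k ^+ 2)^-1.
have k2 : 0 < 2 * k ^+ 2 by rewrite mulr_gt0 // exprn_gt0.
have c0 : 0 < c by rewrite invr_gt0.
have hB x : c * rnorm x <= rnorm (B x).
  rewrite /c ler_pdivrMl //.
  have h1 := cauchy_schwarz (B x) x; rewrite qB in h1.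
  have h2 := kx x.
  have [->|x0] := eqVneq x 0; first by rewrite rnorm0 mulr_ge0 ?rnorm_ge0 // ltW.
  have x1 := rnorm_gt0 x0; rewrite -(ler_pM2r x1).
  have h3 : rnorm x ^+ 2 <= (k * (rnorm (D x) + rnorm (E x))) ^+ 2.
    by rewrite ler_pXn2r ?nnegrE ?rnorm_ge0 // (le_trans (rnorm_ge0 x)).
  have h4 : (rnorm (D x) + rnorm (E x)) ^+ 2 <= 2 * (rnorm (B x) * rnorm x).
    have : 0 <= (rnorm (D x) - rnorm (E x)) ^+ 2 by exact: sqr_ge0.
    nra.
  have -> : 2 * k ^+ 2 * rnorm (B x) * rnorm x = k ^+ 2 * (2 * (rnorm (B x) * rnorm x)).
    by ring.
  rewrite -expr2; apply: (le_trans h3).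
  by rewrite exprMn ler_pM2l ?exprn_gt0.
have [N [bN NB BN]] := selfadj_inverse bB sB c0 hB.
have zid (s t v w : H) : w - t - v = s - v + w - (s + t).
  by rewrite -(addrA s) opprD [RHS]addrACA subrr add0r [LHS]addrAC [in RHS](addrC (- v)).
have fE : finrank E by exact: finrank_oproj.
have bND : BH (N \o D) by exact: BH_comp.
have bDN : BH (D \o N) by exact: BH_comp.
exists (N \o D); split => //.
  apply: finrank_KH.
  (* Write x = B (N x) and use N D^2 = 1 - N E: every remaining term contains the finite rank
     [E]. *)
  apply: (@finrank_ext _ _
    (fun x => (D \o N \o D) (E (N x)) - E (N x) - (D \o N) (E ((D \o N) x)))).
    move=> x; rewrite /= -/(D _).
    have -> : D (N (D x)) = D (N (D (D (D (N x)) + E (N x)))) by rewrite -/(B (N x)) BN.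
    rewrite (BHD bD) (BHD bN) (BHD bD).
    have -> : N (D (D (D (N x)))) = D (N x) - N (E (D (N x))).
      by apply/eqP; rewrite eq_sym subr_eq -(BHD bN) -/(B _) NB.
    rewrite (BHB bD) -[in X in _ = _ - X](BN x) -/E /B.
    set a := D (D (N x)); set b := E (N x); set d := D (N (E (D (N x)))).
    exact: zid.
  apply: finrank_sub; first apply: finrank_sub.
  - apply: finrank_compl; first exact: (BH_comp bDN bD).
    exact: finrank_compr.
  - exact: finrank_compr.
  - by apply: finrank_compl => //; exact: finrank_compr.
apply: finrank_KH.
apply: (@finrank_ext _ _ (fun x => - N (E x))).
  move=> x; rewrite /= -/(D _).
  have -> : N (D (D x)) = x - N (E x).
    by apply/eqP; rewrite eq_sym subr_eq -(BHD bN) -/(B _) NB.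
  by rewrite addrAC subrr add0r.
by apply: finrank_opp; exact: finrank_compl.
Qed.

Definition infdim := forall F : seq H, exists x, rnorm x = 1 /\ orthol F x.

Section EssMin.
Variables (T : H -> H) (hT : BH T) (infH : infdim).
Let P := absop T.
Let bP : BH P. Proof. by case: (absopP hT). Qed.
Let sP : selfadj P. Proof. by case: (absopP hT). Qed.
Let pP x : 0 <= rdot (P x) x. Proof. by case: (absopP hT). Qed.
Let M := opnorm P.

Let vals F := [set rnorm (P x) | x in [set x | rnorm x = 1 /\ orthol F x]].
Let m F := inf (vals F).
(** A max-min value over finite sets of constraints, shown below to be the infimum of the essential
    spectrum of [P]. *)
Let mu := sup (range m).

Let vals_inf F : has_inf (vals F).
Proof.
split; first by have [x hx] := infH F; exists (rnorm (P x)), x.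
by exists 0 => _ [x _ <-]; exact: rnorm_ge0.
Qed.

Let m_le F x : rnorm x = 1 -> orthol F x -> m F <= rnorm (P x).
Proof. by move=> x1 xF; apply: ge_inf (vals_inf F).2 _ _; exists x. Qed.

Let m_ge0 F : 0 <= m F.
Proof. by apply: lb_le_inf; [exact: (vals_inf F).1 | move=> _ [x _ <-]; exact: rnorm_ge0]. Qed.

Let m_sup : has_sup (range m).
Proof.
split; first by exists (m [::]), [::].
exists M => _ [F _ <-]; have [x [x1 xF]] := infH F.
by apply: (le_trans (m_le x1 xF)); have := opnormP x bP; rewrite x1 mulr1.
Qed.

Let m_le_mu F : m F <= mu.
Proof. by apply: ub_le_sup m_sup.2 _ _; exists F. Qed.

Let mu_ge0 : 0 <= mu.
Proof. exact: le_trans (m_ge0 [::]) (m_le_mu [::]). Qed.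

Let mu_lower (b : R) : b < mu ->
  exists2 F, onlist F & forall x, orthol F x -> b * rnorm x <= rnorm (P x).
Proof.
move=> bm; have [_ [F _ <-] hF] := sup_gt m_sup.1 bm.
have [G oG GF] := gram_schmidt F.
exists G => //; apply: unit_scale => // x x1 /GF xF.
exact: le_trans (ltW hF) (m_le x1 xF).
Qed.

Let mu_upper (b : R) F : mu < b -> exists x, [/\ rnorm x = 1, orthol F x & rnorm (P x) < b].
Proof.
move=> bm; have [_ [x [x1 xF] <-] hx] := inf_lt (vals_inf F).1 (le_lt_trans (m_le_mu F) bm).
by exists x.
Qed.

(* With c close to mu and G such that c <= |P| on the complement of G, the
   compression A of P^2 - c^2 to this complement is positive, and <A x, x> is
   small at a near minimizer x of |P x|; hence A x = (P + c) (P - c) x is small. *)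
Let mu_weyl : weyl P mu.
Proof.
move=> e F e0.
have [mu0|mu1] := eqVneq mu 0.
  have [|x [x1 xF hx]] := @mu_upper e F; first by rewrite mu0.
  by exists x; split => //; rewrite mu0 scale0r subr0.
have {}mu1 : 0 < mu by rewrite lt_neqAle eq_sym mu1 mu_ge0.
have M20 : 0 < M ^+ 2 + 1 by rewrite ltr_wpDl ?sqr_ge0.
(* The three bounds give c >= mu / 2, absorb the shift from [c] to [mu], and make |A x| small
   through (mu + d)^2 - c^2 = 4 mu d. *)
pose d := Num.min (Num.min (mu / 2) (e / 4)) (mu * e ^+ 2 / (64 * (M ^+ 2 + 1))).
have d0 : 0 < d by rewrite !lt_min !divr_gt0 ?mulr_gt0 ?exprn_gt0.
have d1 : d <= mu / 2 by rewrite !ge_min lexx.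
have d2 : d <= e / 4 by rewrite !ge_min lexx !orbT.
have d3 : d * (64 * (M ^+ 2 + 1)) <= mu * e ^+ 2.
  by rewrite -ler_pdivlMr ?mulr_gt0 // !ge_min lexx !orbT.
pose c := mu - d.
have [|G oG hG] := @mu_lower c; first by rewrite /c; lra.
pose Q x := x - oproj G x.
have bQ : BH Q by apply: BH_sub; [exact: BH_id | exact: BH_oproj].
have sQ : selfadj Q by move=> x y; rewrite /Q innerBl innerBr oproj_selfadj.
have oQ x : orthol G (Q x) by exact: oproj_ortho.
pose A x := Q (P (P (Q x)) - (c ^+ 2)%:C *: Q x).
have bA : BH A.
  apply: (BH_comp bQ); apply: BH_sub; last exact: BH_scale.
  exact: (BH_comp bP (BH_comp bP bQ)).
have sA : selfadj A.
  move=> x y; by rewrite /A sQ -[RHS]sQ innerBl innerBr innerZl innerZr conj_real !sP.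
have qA x : rdot (A x) x = rnorm (P (Q x)) ^+ 2 - c ^+ 2 * rnorm (Q x) ^+ 2.
  by rewrite /A (selfadj_rdot sQ) rdotBl rdotZl (selfadj_rdot sP) !rdotxx.
have c0 : 0 <= c by rewrite /c; lra.
have pA x : 0 <= rdot (A x) x.
  rewrite qA subr_ge0 -exprMn ler_pXn2r ?nnegrE ?rnorm_ge0 ?mulr_ge0 ?rnorm_ge0 //.
  exact: hG.
have uA x : rdot (A x) x <= M ^+ 2 * rnorm x ^+ 2.
  rewrite qA; have h1 := opnormP (Q x) bP.
  have h2 : rnorm (Q x) <= rnorm x.
    apply: ler_sqr_nneg; rewrite ?rnorm_ge0 //.
    by rewrite (oproj_pythagoras x oG) lerDl sqr_ge0.
  have M0 : 0 <= M by exact: opnorm_ge0.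
  have h3 : rnorm (P (Q x)) ^+ 2 <= (M * rnorm x) ^+ 2.
    rewrite ler_pXn2r ?nnegrE ?rnorm_ge0 ?mulr_ge0 ?rnorm_ge0 //.
    by apply: (le_trans h1); rewrite ler_wpM2l.
  have : 0 <= c ^+ 2 * rnorm (Q x) ^+ 2 by rewrite mulr_ge0 ?sqr_ge0.
  rewrite exprMn in h3; lra.
(* Orthogonality to the vectors P (P g) makes the compression [Q] disappear from A x. *)
have [|x [x1 xF hx]] := @mu_upper (mu + d) (F ++ (G ++ [seq P (P g) | g <- G])).
  by rewrite ltrDl.
have [{}xF /orthol_cat[xG xPG]] := orthol_cat xF.
have Qx : Q x = x by rewrite /Q oproj_eq0 // subr0.
have Ax : A x = P (P x) - (c ^+ 2)%:C *: x.
  rewrite /A Qx /Q oproj_eq0 ?subr0 // => g gG.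
  by rewrite innerBl innerZl xG // mulr0 subr0 !sP xPG //; apply/mapP; exists g.
have hA := positive_norm_le bA sA pA (sqr_ge0 M) uA x.
rewrite qA Qx x1 expr1n mulr1 in hA.
have hA2 : rnorm (A x) ^+ 2 <= M ^+ 2 * (4 * mu * d).
  apply: (le_trans hA); apply: ler_wpM2l; first exact: sqr_ge0.
  have : rnorm (P x) ^+ 2 <= (mu + d) ^+ 2.
    by rewrite ler_pXn2r ?nnegrE ?rnorm_ge0 ?addr_ge0 ?(ltW mu1) ?(ltW d0) ?(ltW hx).
  rewrite /c; nra.
pose z := P x - c%:C *: x.
(* A x = (P + c) z, and positivity of [P] gives <(P + c) z, z> >= c |z|^2. *)
have hz : c * rnorm z <= rnorm (A x).
  have -> : A x = P z + c%:C *: z.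
    rewrite Ax /z (BHB bP) (BHZ bP) scalerBr scalerA -rmorphM -expr2.
    by rewrite addrA subrK.
  have [->|z0] := eqVneq z 0; first by rewrite rnorm0 mulr0 rnorm_ge0.
  have z1 := rnorm_gt0 z0.
  rewrite -(ler_pM2r z1).
  apply: le_trans (cauchy_schwarz (P z + c%:C *: z) z).
  by rewrite rdotDl rdotZl rdotxx -mulrA expr2 lerDr.
have ze : rnorm z < e / 2.
  rewrite ltNge; apply/negP => h.
  have cmu : mu / 2 <= c by rewrite /c; lra.
  have h1 : mu / 2 * (e / 2) <= rnorm (A x).
    apply: le_trans hz; apply: ler_pM => //; rewrite divr_ge0 // ltW //.
  have h2 : (mu / 2 * (e / 2)) ^+ 2 <= rnorm (A x) ^+ 2.
    by rewrite ler_pXn2r ?nnegrE ?rnorm_ge0 // mulr_ge0 // divr_ge0 // ltW.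
  have h3 : M ^+ 2 * (4 * mu * d) < mu ^+ 2 * e ^+ 2 / 16.
    have : M ^+ 2 * d * 64 < mu * e ^+ 2 by nra.
    nra.
  have : (mu / 2 * (e / 2)) ^+ 2 = mu ^+ 2 * e ^+ 2 / 16 by field.
  lra.
exists x; split => //.
have -> : P x - mu%:C *: x = z - d%:C *: x.
  by rewrite /z -addrA -opprD -scalerDl -rmorphD /c subrK.
apply: (le_lt_trans (rnormB _ _)).
by rewrite rnormZ cabsR x1 gtr0_norm //; lra.
Qed.

(** [mu_weyl] puts [mu] in the essential spectrum. Conversely, a Weyl vector for [l] orthogonal to
    [F] has |P x| close to [l], so m F <= l for every [F]. *)
Lemma ess_min_modulusE : ess_min_modulus T = mu.
Proof.
rewrite /ess_min_modulus -/P; set A := [set _ | _].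
have Amu : A mu by exact: weyl_ess_spectrum.
have lA : lbound A mu.
  move=> l /(ess_spectrum_weyl bP sP) hl.
  have l0 : 0 <= l.
    rewrite -oppr_le0; apply: le_eps => e e0; rewrite add0r.
    have [x [x1 _ hx]] := hl e [::] e0.
    have := cauchy_schwarz (P x - l%:C *: x) x.
    rewrite rdotBl rdotZl rdotxx x1 expr1n; have := pP x; lra.
  apply: ge_sup; first exact: m_sup.1.
  move=> _ [F _ <-]; apply: le_eps => e e0.
  have [x [x1 xF hx]] := hl e F e0.
  apply: (le_trans (m_le x1 xF)).
  have := rnorm_lerB (P x) (l%:C *: x); rewrite rnormZ cabsR x1 ger0_norm //; lra.
apply/eqP; rewrite eq_le; apply/andP; split.
  by apply: ge_inf => //; exists mu.
by apply: lb_le_inf => //; exists mu.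
Qed.

Lemma ess_min_modulusP :
  [/\ 0 <= ess_min_modulus T, weyl (absop T) (ess_min_modulus T) &
    forall b : R, b < ess_min_modulus T ->
      exists2 F, onlist F & forall x, orthol F x -> b * rnorm x <= rnorm (T x)].
Proof.
rewrite ess_min_modulusE; split => // b /mu_lower[F oF hF]; exists F => // x /hF.
by rewrite absop_norm.
Qed.

End EssMin.
End EssentialSpectrum.

Arguments infdim {R} H.

(** * Lower bounds for the distance *)

Section Cardinality.
Context {R : realType} {H : hilbertType R}.
Implicit Types (A B : set H).

Lemma orthonormal_dist A x y : orthonormal_set A -> A x -> A y -> x != y ->
  rnorm (x - y) ^+ 2 = 2.
Proof.
move=> oA Ax Ay /negbTE xy.
have h z : A z -> rnorm z ^+ 2 = 1 by move=> Az; rewrite -rdotxx /rdot oA // eqxx.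
by rewrite rnormB2 !h // rdot_inner ?mulr0 ?subr0 // oA // xy.
Qed.

Lemma orthonormal_comp (I : eqType) (D : set I) A (f : I -> H) : orthonormal_set A ->
    (forall i, D i -> A (f i)) -> (forall i j, D i -> D j -> f i = f j -> i = j) ->
  forall i j, D i -> D j -> '[f i, f j] = (i == j)%:R.
Proof.
move=> oA fA finj i j Di Dj; rewrite oA; [|exact: fA|exact: fA].
by congr (_%:R); congr nat_of_bool; apply/eqP/eqP => [|-> //]; exact: finj.
Qed.

Lemma orthonormal_inj (u : nat -> H) :
  (forall n m, '[u n, u m] = (n == m)%:R) -> injective u.
Proof.
move=> ou n m nm; have := ou n m; rewrite nm ou eqxx; case: (n =P m) => // _ h.
by have := oner_neq0 R[i]; rewrite (h : 1 = 0) eqxx.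
Qed.

(** Distinct orthonormal vectors are at distance sqrt 2 > 1, so points of the dense set within 1/2
    of them are distinct. *)
Lemma orthonormal_countable A : separable_space H -> orthonormal_set A -> countable A.
Proof.
move=> [D cD dD] oA.
have ex a : exists d, D d /\ rnorm (d - a) < 2^-1.
  have e0 : 0 < (2^-1 : R)%:C by rewrite (ltcR 0) invr_gt0.
  have [||d [h Dd]] := dD (ball a (2^-1 : R)%:C).
  - by exists a; exact: ballxx.
  - exact: ball_open.
  - exists d; split => //; move: h; rewrite -ball_normE /= norm_rnorm ltcR.
    by rewrite rnormBC.
have [f hf] := choice ex.
have inj : {in A &, injective f}.
  move=> a b; rewrite !inE => Aa Ab fab; apply/eqP/negP => /negP ab.
  have h1 := (hf a).2; have h2 := (hf b).2; rewrite -fab in h2.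
  have h3 := rnorm_dist (f a) a b; rewrite (rnormBC a (f a)) in h3.
  have h4 := orthonormal_dist oA Aa Ab ab.
  have h5 := rnorm_ge0 (a - b).
  have h6 : rnorm (a - b) < 1 by lra.
  by move: h4 h5 h6 {ab}; nra.
apply: card_le_trans cD.
have /card_eqPle[_ h] : f @` A #= A by exact: inj_card_eq.
by apply: card_le_trans h _; apply: subset_card_le => _ [a _ <-]; exact: (hf a).1.
Qed.

End Cardinality.

Section Distance.
Context {R : realType} {H : hilbertType R}.
Implicit Types (x y z : H) (S T U V : H -> H) (s F : seq H).

(* Encodes dim ker S < dim ker S^* with dim ker S finite. *)
Definition kernel_gap S s (f : H -> H) b :=
  [/\ onlist s, forall a, a \in s -> S a = 0, forall x, S x = 0 -> orthol s x -> x = 0,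
      forall a, a \in s -> adjoint S (f a) = 0 &
      (forall a a', a \in s -> a' \in s -> '[f a, f a'] = (a == a')%:R) /\
      [/\ adjoint S b = 0, '[b, b] = 1 & forall a, a \in s -> '[f a, b] = 0]].

Lemma sum_onlist s (f : H -> H) x a : onlist s ->
    (forall a a', a \in s -> a' \in s -> '[f a, f a'] = (a == a')%:R) ->
  a \in s -> '[\sum_(v <- s) '[x, v] *: f v, f a] = '[x, a].
Proof.
move=> [us os] of_ ais; rewrite inner_suml (bigD1_seq a) //= innerZl (of_ a a) // eqxx mulr1.
rewrite big_seq_cond big1 ?addr0 // => w /andP[ws /negbTE wa].
by rewrite innerZl (of_ w a) // wa mulr0.
Qed.

(* If V = S + t has a right inverse then the left inverse R of S on the complement
   of F satisfies R = Z + finite rank with Z injective, whence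
   Z S = 1 + finite rank and the index of S is zero. *)
Lemma no_kernel_gap S s f b F (beta t : R) : BH S -> kernel_gap S s f b ->
    onlist F -> 0 < beta -> (forall x, orthol F x -> beta * rnorm x <= rnorm (S x)) ->
    0 <= t < beta ->
  ~ (exists2 Vi, BH Vi & forall x, S (Vi x) + t%:C *: Vi x = x).
Proof.
move=> bS [os sS kS fS [of_ [Sb bb fb]]] oF b0 hF /andP[t0 tb] [Vi bVi VV2].
pose E := oproj F; have bE : BH E by exact: BH_oproj.
have sE : selfadj E by exact: oproj_selfadj.
have EE x : E (E x) = E x by exact: oproj_id.
pose Q x := x - E x.
have bQ : BH Q by apply: BH_sub => //; exact: BH_id.
have sQ : selfadj Q by move=> x y; rewrite /Q innerBl innerBr sE.
have EQ x : E (Q x) = 0 by rewrite /Q (BHB bE) EE subrr.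
have QQ x : Q (Q x) = Q x by rewrite {1}/Q EQ subr0.
have oQ x : orthol F (Q x) by exact: oproj_ortho.
have bSa := BH_adjoint bS.
(* [B0] is bounded below by beta^2; its inverse yields a left inverse [L] of [S] on the complement
   of [F], of norm at most 1 / beta. *)
pose B0 x := Q (adjoint S (S (Q x))) + (beta ^+ 2)%:C *: E x.
have bB0 : BH B0.
  apply: BH_add; last exact: BH_scale.
  exact: (BH_comp bQ (BH_comp bSa (BH_comp bS bQ))).
have sB0 : selfadj B0.
  move=> x y; rewrite /B0 innerDl innerDr innerZl innerZr conj_real sE sQ -[X in _ = X + _]sQ.
  by rewrite -(adjointE' bS) (adjointE bS).
have qB0 x : rdot (B0 x) x = rnorm (S (Q x)) ^+ 2 + beta ^+ 2 * rnorm (E x) ^+ 2.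
  rewrite /B0 rdotDl rdotZl (selfadj_rdot sQ) -(rdot_adjoint' bS) rdotxx; congr (_ + _ * _).
  by rewrite -[in LHS]EE (selfadj_rdot sE) rdotxx.
have hB0 x : beta ^+ 2 * rnorm x <= rnorm (B0 x).
  have [->|x0] := eqVneq x 0; first by rewrite rnorm0 mulr0 rnorm_ge0.
  have x1 := rnorm_gt0 x0; rewrite -(ler_pM2r x1).
  apply: le_trans (cauchy_schwarz (B0 x) x); rewrite qB0 -mulrA -expr2.
  rewrite (oproj_pythagoras x oF) mulrDr lerD2r -exprMn.
  by rewrite ler_pXn2r ?nnegrE ?mulr_ge0 ?rnorm_ge0 ?(ltW b0) //; exact: (hF _ (oQ x)).
have b2 : 0 < beta ^+ 2 by rewrite exprn_gt0.
have [N [bN NB BN]] := selfadj_inverse bB0 sB0 b2 hB0.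
pose L x := N (Q (adjoint S x)).
have bL : BH L by exact: (BH_comp bN (BH_comp bQ bSa)).
have LSQ x : L (S (Q x)) = Q x.
  by rewrite -[RHS]NB /B0 QQ EQ scaler0 addr0.
have nL x : beta * rnorm (L x) <= rnorm x.
  set z := L x.
  have Bz : B0 z = Q (adjoint S x) by exact: BN.
  have Ez : E z = 0.
    have : E (B0 z) = 0 by rewrite Bz EQ.
    rewrite /B0 (BHD bE) EQ add0r (BHZ bE) EE => /eqP.
    rewrite scaler_eq0 => /predU1P[|/eqP //].
    by move=> /eqP; rewrite fmorph_eq0 gt_eqF.
  have Qz : Q z = z by rewrite /Q Ez subr0.
  have oz : orthol F z by rewrite -Qz.
  apply: (le_trans (hF _ oz)).
  have : rnorm (S z) ^+ 2 <= rnorm x * rnorm (S z).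
    apply: le_trans (cauchy_schwarz x (S z)).
    have := qB0 z; rewrite Bz Ez rnorm0 expr0n /= mulr0 addr0 Qz => <-.
    by rewrite (selfadj_rdot sQ) Qz -(rdot_adjoint' bS).
  have [->|z0] := eqVneq (S z) 0; first by rewrite rnorm0 rnorm_ge0.
  by rewrite expr2 ler_pM2r ?rnorm_gt0.
pose G1 x := E x - L (S (E x)).
have LS x : L (S x) = x - G1 x.
  have e : x = Q x + E x by rewrite /Q subrK.
  by rewrite {1}e (BHD bS) (BHD bL) LSQ /G1 /Q opprD opprK addrA.
have fG1 : finrank G1.
  apply: finrank_sub; first exact: finrank_oproj.
  exact: (finrank_compl (BH_comp bL bS) (finrank_oproj F)).
(* Injective because t |L x| <= (t / beta) |x| and t < beta. *)
pose W0 x := x + t%:C *: L x.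
have W0inj x : W0 x = 0 -> x = 0.
  move=> h; apply: rnorm_eq0; apply/eqP; rewrite eq_le rnorm_ge0 andbT.
  have : rnorm x = t * rnorm (L x).
    have <- : rnorm (t%:C *: L x) = rnorm x by rewrite -(addr0_eq h) rnormN.
    by rewrite rnormZ cabsR ger0_norm.
  have := nL x; have := rnorm_ge0 (L x); have := rnorm_ge0 x.
  by move=> h1 h2 h3 h4; nra.
pose Z x := W0 (Vi x).
have bZ : BH Z.
  apply: (BH_comp _ bVi); apply: BH_add; [exact: BH_id | exact: BH_scale].
have Zinj x : Z x = 0 -> x = 0.
  by move=> /W0inj h; rewrite -(VV2 x) h (BH0 bS) scaler0 addr0.
have LZ y : L y = Z y - G1 (Vi y).
  rewrite -{1}(VV2 y) (BHD bL) (BHZ bL) LS /Z /W0.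
  by rewrite addrAC.
have ZS x : Z (S x) = x - (G1 x - G1 (Vi (S x))).
  by have := LZ (S x); rewrite LS => h; rewrite opprB addrA addrAC h subrK.
(* [J] maps ker S isometrically into the kernel of the adjoint, orthogonally to [b]. Then S + J is
   injective and Z (S + J) = 1 - K, so [fredholm] would put [b] in the range of S + J. *)
pose J x := \sum_(v <- s) '[x, v] *: f v.
have fJ : finrank J by exists [seq (v, f v) | v <- s] => x; rewrite big_map.
have Jfa x a : a \in s -> '[J x, f a] = '[x, a] by exact: sum_onlist.
have Sf x a : a \in s -> '[S x, f a] = 0.
  by move=> ais; rewrite (adjointE bS) fS // inner0r.
have SJ x y : '[S x, J y] = 0.
  rewrite /J inner_sumr big_seq big1 // => a ais.
  by rewrite innerZr Sf // mulr0.
have S'inj x : S x + J x = 0 -> x = 0.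
  move=> h; have := pythagoras (SJ x x); rewrite h rnorm0 expr0n /= => h1.
  have [Sx Jx] : S x = 0 /\ J x = 0.
    have := sqr_ge0 (rnorm (S x)); have := sqr_ge0 (rnorm (J x)) => h2 h3.
    by split; apply: rnorm_eq0; apply/eqP; rewrite -sqrf_eq0; apply/eqP; lra.
  by apply: kS => // a ais; rewrite -Jfa // Jx inner0l.
have bJ := BH_finrank fJ.
pose K x := G1 x - G1 (Vi (S x)) - Z (J x).
have fK : finrank K.
  apply: finrank_sub; last exact: finrank_compl.
  apply: finrank_sub => //; exact: (finrank_compr (BH_comp bVi bS) fG1).
have ZK x : Z (S x + J x) = x - K x.
  rewrite (BHD bZ) ZS /K; set u := G1 x - _.
  by rewrite (opprB u) [RHS]addrCA [RHS]addrC.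
have Kinj x : K x = x -> x = 0.
  by move=> h; apply/S'inj/Zinj; rewrite ZK h subrr.
have [x hx] := fredholm fK Kinj (Z b).
have : S x + J x = b.
  apply/eqP; rewrite -subr_eq0; apply/eqP/Zinj.
  by rewrite (BHB bZ) ZK hx subrr.
move=> /(congr1 (fun u => '[u, b])); rewrite bb innerDl (adjointE bS) Sb inner0r add0r.
rewrite /J inner_suml big_seq big1 => [/esym/eqP|a ais]; first by rewrite oner_eq0.
by rewrite innerZl fb // mulr0.
Qed.

Lemma opdist_eq T (v : R) :
    (forall l U, unitary U -> v <= opnorm (fun x => T x - l *: U x)) ->
    (forall e : R, 0 < e -> exists l U, unitary U /\ opnorm (fun x => T x - l *: U x) <= v + e) ->
  opdist T (scaled_unitary H) = v.
Proof.
move=> h1 h2; rewrite /opdist; set D := [set _ | _ in _].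
have lD : lbound D v by move=> _ [_ [l _ [U uU <-]] <-]; exact: h1.
have mem l U : unitary U -> D (opnorm (fun x => T x - l *: U x)).
  by move=> uU; exists (fun x => l *: U x) => //; exists l => //; exists U.
apply/eqP; rewrite eq_le; apply/andP; split; last first.
  apply: lb_le_inf => //; have [l [U [uU _]]] := h2 1 ltr01.
  by exists (opnorm (fun x => T x - l *: U x)); exact: mem.
apply: le_eps => e e0; have [l [U [uU hU]]] := h2 e e0.
by apply: le_trans hU; apply: ge_inf; [exists v | exact: mem].
Qed.

Lemma unitary_comp_adjoint U : unitary U -> unitary (adjoint U).
Proof.
by move=> [hU h1 h2]; split; rewrite ?adjointK //; exact: BH_adjoint.
Qed.

Lemma adjoint_scaleU (l : R[i]) T U : BH T -> BH U ->
  adjoint (fun x => T x - l *: U x) = (fun x => adjoint T x - Num.conj l *: adjoint U x).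
Proof.
move=> bT bU; apply: adjoint_unique; first by apply: BH_sub => //; exact: BH_scale.
move=> x y; rewrite innerBl innerBr innerZl innerZr conjCK.
by rewrite (adjointE bT) (adjointE bU).
Qed.

Lemma opdist_adjoint_sub T : BH T ->
  [set opnorm (T \- A) | A in scaled_unitary H] `<=`
  [set opnorm (adjoint T \- A) | A in scaled_unitary H].
Proof.
move=> bT _ [_ [l _ [U uU <-]] <-].
have [bU _ _ _ _] := unitaryP uU.
exists (fun x => Num.conj l *: adjoint U x).
  exists (Num.conj l) => //; exists (adjoint U) => //; exact: unitary_comp_adjoint.
rewrite -(@opnorm_adjoint _ _ (fun x => T x - l *: U x)); last first.
  by apply: BH_sub => //; exact: BH_scale.
by rewrite adjoint_scaleU.
Qed.

Lemma opdist_adjoint T : BH T ->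
  opdist (adjoint T) (scaled_unitary H) = opdist T (scaled_unitary H).
Proof.
move=> bT; rewrite /opdist; congr inf; apply/seteqP; split.
  by rewrite -{2}(adjointK bT); apply: opdist_adjoint_sub; exact: BH_adjoint.
exact: opdist_adjoint_sub.
Qed.

Lemma opnorm_scaleU_ge T (l : R[i]) U : BH T -> unitary U ->
  opnorm T <= opnorm (fun x => T x - l *: U x) + cabs l.
Proof.
move=> bT /unitaryP[bU _ _ _ nU].
have bA : BH (fun x => T x - l *: U x) by apply: BH_sub => //; exact: BH_scale.
apply: opnorm_le => [|x]; first by rewrite addr_ge0 ?opnorm_ge0 ?cabs_ge0.
have := opnormP x bA; have := rnormD (T x - l *: U x) (l *: U x).
rewrite subrK rnormZ nU mulrDl; lra.
Qed.

Lemma unitary_scale (a : R[i]) U : cabs a = 1 -> unitary U -> unitary (fun x => a *: U x).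
Proof.
move=> a1 uU; have [bU iU aU Ua nU] := unitaryP uU.
have aa : a * Num.conj a = 1 by rewrite mulcJ a1 expr1n.
have bA : BH (fun x => a *: U x) by exact: BH_scale.
have e : adjoint (fun x => a *: U x) = (fun x => Num.conj a *: adjoint U x).
  apply: adjoint_unique => // x y.
  by rewrite innerZl innerZr conjCK (adjointE bU).
split => //; rewrite e; apply: funext => x /=.
  by rewrite (BHZ bU) Ua scalerA aa scale1r.
by rewrite (BHZ (BH_adjoint bU)) aU scalerA mulrC aa scale1r.
Qed.

Lemma gap_lower T s f b (l : R[i]) U : BH T -> kernel_gap T s f b -> infdim H -> unitary U ->
  (opnorm T + ess_min_modulus T) / 2 <= opnorm (fun x => T x - l *: U x).
Proof.
move=> bT gap infH uU.
have [bU _ _ _ nU] := unitaryP uU.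
have bA : BH (fun x => T x - l *: U x) by apply: BH_sub => //; exact: BH_scale.
have h1 := opnorm_scaleU_ge l bT uU.
set N := opnorm (fun x => T x - l *: U x) in h1 *; set r := cabs l in h1 *.
set al := ess_min_modulus T.
suff : al + r <= N by lra.
have [al0 _ hal] := ess_min_modulusP bT infH.
have [os sS kS fS [of_ [Sb bb fb]]] := gap.
have b1 : rnorm b = 1.
  by apply: eqr_sqr_nneg; rewrite ?rnorm_ge0 // expr1n -rdotxx /rdot bb.
(* Tested on the preimage of [b] under [U]: as [b] is orthogonal to the range of [T], only - l
   remains. This makes [al] positive if the claim fails. *)
have rN : r <= N.
  have [_ _ _ Ua _] := unitaryP uU.
  have := opnormP (adjoint U b) bA; rewrite -/N.
  have -> : rnorm (adjoint U b) = 1 by rewrite -b1 -(nU (adjoint U b)) Ua.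
  rewrite mulr1 Ua; apply: le_trans.
  have h := cauchy_schwarz_inner (T (adjoint U b) - l *: b) b.
  move: h; rewrite b1 mulr1; apply: le_trans.
  rewrite innerBl (adjointE bT) Sb inner0r innerZl bb mulr1 sub0r.
  by rewrite /cabs normrN.
rewrite leNgt; apply/negP => hN.
have r0 : 0 <= r by exact: cabs_ge0.
have al1 : 0 < al by lra.
(* Midpoint of N - r and al, while [beta] is the midpoint of t and al; hence N < r + t and t < beta
   < al. *)
pose t := (N - r + al) / 2.
have t0 : 0 <= t by rewrite /t; lra.
have ta : t < al by rewrite /t; lra.
pose beta := (t + al) / 2.
have tb : t < beta by rewrite /beta; lra.
have ba : beta < al by rewrite /beta; lra.
have rt : N < r + t by rewrite /t; lra.
have [F oF hF] := hal beta ba.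
(* The phase of [l] is moved into the unitary. *)
have [U' uU' lU] : exists2 U', unitary U' & forall x, l *: U x = r%:C *: U' x.
  have [l0|l0] := eqVneq l 0.
    by exists U => // x; rewrite /r l0 /cabs normr0 !scale0r.
  have r1 : r != 0 by rewrite cabs_eq0.
  exists (fun x => (l / r%:C) *: U x).
    apply: unitary_scale => //; rewrite cabsM cabsV cabsR ger0_norm // divff //.
  by move=> x; rewrite scalerA mulrC divfK // fmorph_eq0.
have [bU' iU' aU' Ua' nU'] := unitaryP uU'.
have bUa := BH_adjoint bU'.
have nUa x : rnorm (adjoint U' x) = rnorm x by rewrite -{2}(Ua' x) nU'.
pose S x := adjoint U' (T x).
have bS : BH S by exact: BH_comp.
have Sa : adjoint S = (fun x => adjoint T (U' x)).
  apply: adjoint_unique => // x y.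
  by rewrite /S -(adjointE' bU') (adjointE bT).
pose V x := S x + t%:C *: x.
have bV : BH V by apply: BH_add => //; exact: (BH_scale _ BH_id).
have VA x : V x = adjoint U' (T x - l *: U x) + (r + t)%:C *: x.
  rewrite lU (BHB bUa) (BHZ bUa) aU' rmorphD scalerDl addrA.
  by rewrite subrK.
have c0 : 0 < r + t - N by lra.
have hV x : (r + t - N) * rnorm x <= rnorm (V x).
  have h2 : rnorm (adjoint U' (T x - l *: U x)) <= N * rnorm x.
    by rewrite nUa; exact: (opnormP x bA).
  have := rnorm_lerB ((r + t)%:C *: x) (- adjoint U' (T x - l *: U x)).
  rewrite opprK rnormN rnormZ cabsR ger0_norm ?addr_ge0 // [_ + adjoint _ _]addrC -VA.
  rewrite !mulrBl in h2 *; lra.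
have iV x : adjoint V x = 0 -> x = 0.
  have -> : adjoint V = fun x => adjoint (fun x => T x - l *: U x) (U' x) + (r + t)%:C *: x.
    apply: adjoint_unique => // y z.
    rewrite VA innerDl innerDr innerZl innerZr -(adjointE' bU') (adjointE bA).
    by rewrite conj_real.
  move=> h; apply: rnorm_eq0; apply/eqP; rewrite eq_le rnorm_ge0 andbT.
  have h2 := opnormP (U' x) (BH_adjoint bA); rewrite (opnorm_adjoint bA) nU' -/N in h2.
  have h3 : rnorm (adjoint (fun x => T x - l *: U x) (U' x)) = (r + t) * rnorm x.
    move/eqP: h; rewrite addr_eq0 => /eqP ->.
    by rewrite rnormN rnormZ cabsR ger0_norm ?addr_ge0.
  by rewrite h3 -subr_ge0 -mulrBl in h2; rewrite -(pmulr_rle0 _ c0); lra.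
have [Vi [bVi ViV VVi]] := inverse_exists bV c0 hV iV.
apply: (@no_kernel_gap S s (adjoint U' \o f) (adjoint U' b) F beta t) => //.
- have iUa x y : '[adjoint U' x, adjoint U' y] = '[x, y] by rewrite -(adjointE' bU') Ua'.
  split => //=.
  + by move=> a ais; rewrite /S sS // (BH0 bUa).
  + by move=> x Sx; apply: kS; rewrite -(Ua' (T x)) -/(S x) Sx (BH0 bU').
  + by move=> a ais; rewrite Sa Ua' fS.
  + split; first by move=> a a' ais a's; rewrite iUa of_.
    by split; rewrite ?Sa ?Ua' ?iUa // => a ais; rewrite iUa fb.
- by rewrite /beta; lra.
- by move=> x xF; rewrite /S nUa; exact: hF.
- by rewrite t0.
- by exists Vi.
Qed.

End Distance.
(** * Upper bounds for the distance *)

Section UpperBounds.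
Context {R : realType} {H : hilbertType R}.
Implicit Types (x y z : H) (S T U V : H -> H) (s F : seq H) (A B : set H).

Lemma ker_absop T x : BH T -> absop T x = 0 <-> T x = 0.
Proof.
move=> bT; split=> h; apply: rnorm_eq0.
  by rewrite -(absop_norm _ bT) h rnorm0.
by rewrite absop_norm // h rnorm0.
Qed.

(* T = V |T| on the range of |T|, completed by f on ker T. *)
Lemma polar_generators T A (f : H -> H) : BH T -> orthonormal_basis (ker T) A ->
    (forall a, A a -> adjoint T (f a) = 0) ->
    (forall a a', A a -> A a' -> '[f a, f a'] = (a == a')%:R) ->
  let g x y := (exists z, x = absop T z /\ y = T z) \/ (exists a, [/\ A a, x = a & y = f a]) in
  (forall x y x' y', g x y -> g x' y' -> '[x, x'] = '[y, y']) /\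
  (forall z, (forall x y, g x y -> '[z, x] = 0) -> z = 0).
Proof.
move=> bT [AT oA mA] fT of_ g; have [bP sP _ iP] := absopP bT.
have Pa a : A a -> absop T a = 0 by move=> /AT Ta; apply/ker_absop.
split.
  move=> x y x' y' [[z [-> ->]]|[a [Aa -> ->]]] [[z' [-> ->]]|[a' [Aa' -> ->]]].
  - exact: iP.
  - by rewrite sP Pa // inner0r (adjointE bT) fT // inner0r.
  - by rewrite -sP Pa // inner0l (adjointE' bT) fT // inner0l.
  - by rewrite oA // of_.
move=> z hz; apply: mA.
  apply/(ker_absop _ bT)/inner_ext => y.
  by rewrite sP; apply: (hz _ (T y)); left; exists y.
by move=> a Aa; apply: (hz _ (f a)); right; exists a.
Qed.

(** For m > 0 let N be the inverse of [P]. Positivity at x - m N x gives <P x, x> >= 2 m |x|^2 - m^2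
    <x, N x>, and |N x| <= |x| / m. *)
Lemma positive_lower P (m : R) : BH P -> selfadj P -> (forall x, 0 <= rdot (P x) x) ->
    0 <= m -> (forall x, m * rnorm x <= rnorm (P x)) ->
  forall x, m * rnorm x ^+ 2 <= rdot (P x) x.
Proof.
move=> bP sP pP m0 hm x.
have [->|m1] := eqVneq m 0; first by rewrite mul0r.
have {m1}m0 : 0 < m by rewrite lt_neqAle eq_sym m1.
have [N [bN NP PN]] := selfadj_inverse bP sP m0 hm.
have := pP (x - m%:C *: N x); rewrite (BHB bP) (BHZ bP) PN.
rewrite !(rdotBl, rdotBr, rdotZl, rdotZr) (selfadj_rdot sP x (N x)) PN !rdotxx.
have h1 := cauchy_schwarz x (N x).
have h2 := hm (N x); rewrite PN in h2.
have h3 : m * rdot x (N x) <= rnorm x ^+ 2.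
  have h4 : m * rdot x (N x) <= m * (rnorm x * rnorm (N x)) by rewrite ler_pM2l.
  apply: (le_trans h4); rewrite mulrCA expr2 ler_wpM2l ?rnorm_ge0 //.
nra.
Qed.

(** For D = P - m, the inequality |D x|^2 <= (M - m) <D x, x> is the claim once the square is
    expanded. *)
Lemma positive_center P (m M : R) : BH P -> selfadj P -> m <= M ->
    (forall x, m * rnorm x ^+ 2 <= rdot (P x) x) -> (forall x, rnorm (P x) <= M * rnorm x) ->
  forall x, rnorm (P x - ((M + m) / 2)%:C *: x) <= (M - m) / 2 * rnorm x.
Proof.
move=> bP sP mM hm hM x.
pose D y := P y - m%:C *: y.
have bD : BH D by apply: BH_sub => //; exact: (BH_scale _ BH_id).
have sD : selfadj D by exact: selfadj_shift.
have qD y : rdot (D y) y = rdot (P y) y - m * rnorm y ^+ 2.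
  by rewrite /D rdotBl rdotZl rdotxx.
have pD y : 0 <= rdot (D y) y by rewrite qD subr_ge0.
have uD y : rdot (D y) y <= (M - m) * rnorm y ^+ 2.
  rewrite qD mulrBl lerD2r expr2 mulrA.
  apply: (le_trans (cauchy_schwarz _ _)); rewrite ler_wpM2r ?rnorm_ge0 //.
have Mm : 0 <= M - m by rewrite subr_ge0.
have h := positive_norm_le bD sD pD Mm uD x.
set c := (M - m) / 2; have c0 : 0 <= c by rewrite divr_ge0.
have -> : P x - ((M + m) / 2)%:C *: x = D x - c%:C *: x.
  rewrite /D -addrA -opprD -scalerDl -rmorphD /=; congr (_ - _%:C *: _).
  by rewrite /c; field.
apply: ler_sqr_nneg; rewrite ?rnorm_ge0 ?mulr_ge0 ?rnorm_ge0 //.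
rewrite rnormB2 rdotZr rnormZ cabsR ger0_norm // gerDr.
have -> : 2 * (c * rdot (D x) x) = (M - m) * rdot (D x) x by rewrite /c; field.
by rewrite subr_le0.
Qed.

Lemma absop_bounded T x : BH T -> rnorm (absop T x) <= opnorm T * rnorm x.
Proof. by move=> bT; rewrite absop_norm //; exact: opnormP. Qed.

Lemma min_modulus_has_inf T : (exists x : H, rnorm x = 1) ->
  has_inf [set rnorm (T x) | x in [set x | rnorm x = 1]].
Proof.
move=> [x x1]; split; first by exists (rnorm (T x)), x.
by exists 0 => _ [y _ <-]; exact: rnorm_ge0.
Qed.

(** The bijection of kernel bases makes the polar generators total on both sides, so [V] is unitary
    and T - c V = V (P - c); [c] is the centre of [m, M]. *)
Lemma opdist_eq_kernels T A B : BH T -> (exists x : H, rnorm x = 1) ->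
    orthonormal_basis (ker T) A -> orthonormal_basis (ker (adjoint T)) B -> A #= B ->
  opdist T (scaled_unitary H) = (opnorm T - min_modulus T) / 2.
Proof.
move=> bT ex1 bA bB /card_set_bijP[f [fAB finj fsurj]].
have hi := min_modulus_has_inf T ex1.
have [x1 hx1] := ex1.
set m := min_modulus T; set M := opnorm T.
have m_le x : m * rnorm x <= rnorm (T x).
  apply: (@unit_scale _ _ [::]) => // y y1 _.
  by apply: ge_inf hi.2 _ _; exists y.
have m0 : 0 <= m.
  by apply: lb_le_inf hi.1 _ => _ [y _ <-]; exact: rnorm_ge0.
have mM : m <= M.
  by have := le_trans (m_le x1) (opnormP x1 bT); rewrite hx1 !mulr1.
apply: opdist_eq.
  move=> l U uU; have h1 := opnorm_scaleU_ge l bT uU.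
  have [bU _ _ _ nU] := unitaryP uU.
  have bD : BH (fun x => T x - l *: U x) by apply: BH_sub => //; exact: BH_scale.
  rewrite -/M in h1; set N := opnorm _ in h1 *.
  suff : cabs l - N <= m by lra.
  apply: lb_le_inf hi.1 _ => _ [y y1 <-].
  have := opnormP y bD; rewrite -/N y1 mulr1.
  have := rnorm_lerB (l *: U y) (T y); rewrite rnormZ nU y1 mulr1 rnormBC; lra.
move=> e e0; have [bP sP pP iP] := absopP bT.
have [BT oB mB] := bB.
have [||gi gd] := @polar_generators T A f bT bA.
- by move=> a Aa; apply: BT; apply: fAB.
- apply: (orthonormal_comp oB fAB) => a a' Aa Aa'.
  by apply: finj; rewrite inE.
set g := (X in forall x y x' y', X x y -> _) in gi gd.
have gr z : (forall x y, g x y -> '[z, y] = 0) -> z = 0.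
  move=> hz; apply: mB.
    apply: inner_ext => y; rewrite -(adjointE' bT).
    by apply: (hz (absop T y)); left; exists y.
  move=> _ /fsurj[a Aa <-]; apply: (hz a); right; by exists a.
have [V uV gV] := unitary_extension gi gd gr.
have [bV _ _ _ nV] := unitaryP uV.
have VP x : V (absop T x) = T x by apply: gV; left; exists x.
exists (((M + m) / 2)%:C), V; split => //.
apply: (@le_trans _ _ ((M - m) / 2)); last by rewrite lerDl ltW.
apply: opnorm_le => [|x]; first by rewrite divr_ge0 // subr_ge0.
rewrite -VP -(BHZ bV) -(BHB bV) nV.
apply: positive_center => //; last by move=> y; exact: absop_bounded.
by apply: positive_lower => // y; rewrite absop_norm.
Qed.

(* Choosing u n orthogonal to u k, P (u k) and P (P (u k)) for k < n makes the
   errors (P - al) (u n) mutually orthogonal, so that a uniform bound on their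
   norms controls P - al on the closed span of the u n. *)
Lemma weyl_sequence P (al e : R) : BH P -> selfadj P -> weyl P al -> 0 < e ->
  exists u : nat -> H,
    [/\ forall n m, '[u n, u m] = (n == m)%:R,
        forall n m, n != m -> '[P (u n) - al%:C *: u n, P (u m) - al%:C *: u m] = 0 &
        forall n, rnorm (P (u n) - al%:C *: u n) <= e].
Proof.
move=> bP sP hW e0.
have ex F : exists x, [/\ rnorm x = 1, orthol F x & rnorm (P x - al%:C *: x) < e] := hW e F e0.
have [pk hpk] := choice ex.
pose L := fix L n : seq H := if n is k.+1 then
  [:: pk (L k), P (pk (L k)), P (P (pk (L k))) & L k] else [::].
pose u n := pk (L n).
have memL n k : (k < n)%N ->
    [/\ u k \in L n, P (u k) \in L n & P (P (u k)) \in L n].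
  elim: n => [//|n ih]; rewrite ltnS leq_eqVlt => /predU1P[->|/ih[h1 h2 h3]].
    by rewrite /= !inE !eqxx !orbT.
  by rewrite /= !inE h1 h2 h3 !orbT.
have ort n k : (k < n)%N ->
    [/\ '[u n, u k] = 0, '[u n, P (u k)] = 0 & '[u n, P (P (u k))] = 0].
  move=> kn; have [h1 h2 h3] := memL n k kn; have [_ h _] := hpk (L n).
  by split; exact: h.
have ort2 n k : (k < n)%N -> '[P (u n) - al%:C *: u n, P (u k) - al%:C *: u k] = 0.
  move=> /ort[h1 h2 h3]; rewrite innerBl !innerBr !innerZl !innerZr !sP h1 h2 h3.
  by rewrite !mulr0 !subr0.
exists u; split.
- move=> n k; case: (ltngtP n k) => [nk|kn|->].
  + by rewrite innerC; have [-> _ _] := ort k n nk; rewrite rmorph0.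
  + by have [-> _ _] := ort n k kn.
  + by have [h _ _] := hpk (L k); rewrite inner_rnorm h expr1n.
- move=> n k; case: ltngtP => // [nk|kn] _; last exact: ort2.
  by rewrite innerC ort2 // rmorph0.
- by move=> n; have [_ _ /ltW] := hpk (L n).
Qed.

Section ApproximateEigenspace.
Variables (P : H -> H) (al e : R) (u : nat -> H).
Hypotheses (bP : BH P) (e0 : 0 <= e).
Hypothesis ou : forall n m, '[u n, u m] = (n == m)%:R.
Hypothesis oPu : forall n m, n != m -> '[P (u n) - al%:C *: u n, P (u m) - al%:C *: u m] = 0.
Hypothesis hu : forall n, rnorm (P (u n) - al%:C *: u n) <= e.

Let D x := P x - al%:C *: x.
Let bD : BH D. Proof. by apply: BH_sub => //; exact: (BH_scale _ BH_id). Qed.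
Let es n := [seq u i | i <- iota 0 n].
Let E n := oproj (es n).

Let u_inj : injective u.
Proof. exact: orthonormal_inj. Qed.

Let un1 n : rnorm (u n) = 1.
Proof. by apply: eqr_sqr_nneg; rewrite ?rnorm_ge0 // expr1n -rdotxx /rdot ou eqxx. Qed.

Let os n : onlist (es n).
Proof.
split; first by rewrite (map_inj_uniq u_inj) iota_uniq.
by move=> _ _ /mapP[i _ ->] /mapP[j _ ->]; rewrite ou (inj_eq u_inj).
Qed.

Let ES n x : E n.+1 x = E n x + '[x, u n] *: u n.
Proof.
rewrite /E /oproj /es -addn1 iotaD map_cat big_cat /= add0n.
by rewrite big_cons big_nil addr0.
Qed.

Let E_eq n x : E n x = \sum_(i < n) '[x, u i] *: u i.
Proof. by rewrite /E /oproj /es big_map -{1}(subn0 n) -/(index_iota 0 n) big_mkord. Qed.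

Let DE n x : rnorm (D (E n x)) <= e * rnorm (E n x).
Proof.
apply: ler_sqr_nneg; rewrite ?mulr_ge0 ?rnorm_ge0 //.
elim: n => [|n ih]; first by rewrite /E /oproj big_nil (BH0 bD) rnorm0 mulr0.
rewrite ES (BHD bD) (BHZ bD).
have o1 : '[E n x, u n] = 0.
  rewrite E_eq inner_suml big1 // => i _.
  by rewrite innerZl ou ltn_eqF ?mulr0.
have o2 : '[D (E n x), D (u n)] = 0.
  rewrite E_eq (BH_sum bD) inner_suml big1 // => i _.
  by rewrite (BHZ bD) innerZl oPu ?mulr0 // ltn_eqF.
rewrite exprMn (pythagoras (x := E n x)); last by rewrite innerZr o1 mulr0.
rewrite (pythagoras (x := D (E n x))); last by rewrite innerZr o2 mulr0.
rewrite mulrDr -exprMn lerD // !rnormZ !exprMn mulrCA ler_wpM2l ?sqr_ge0 //.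
rewrite un1 expr1n mulr1 ler_pXn2r ?nnegrE ?rnorm_ge0 //; exact: hu.
Qed.

Let E_le n x : rnorm (E n x) <= rnorm x.
Proof.
apply: ler_sqr_nneg; rewrite ?rnorm_ge0 //.
by rewrite [leRHS](oproj_pythagoras x (os n)) lerDr sqr_ge0.
Qed.

Let BE_le n x : rnorm (x - E n x) <= rnorm x.
Proof.
apply: ler_sqr_nneg; rewrite ?rnorm_ge0 //.
by rewrite [leRHS](oproj_pythagoras x (os n)) lerDl sqr_ge0.
Qed.

Lemma seq_ortho_closed : closed_subspace [set x | forall n, '[x, u n] = 0].
Proof.
split => [n|a x y hx hy n|w l hw wl n] /=; first by rewrite inner0l.
  by rewrite innerDl innerZl hx hy mulr0 addr0.
apply/eqP; rewrite -cabs_eq0 eq_le cabs_ge0 andbT; apply: le_eps => d d0.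
have [N hN] := wl _ d0; have := hN N (leqnn _) => h.
have := cauchy_schwarz_inner (w N - l) (u n).
rewrite innerBl hw sub0r /cabs normrN -/(cabs _).
rewrite un1; lra.
Qed.

(** The hypothesis places [x] in the closed span of the [u n], so E n x tends to [x] and [DE] passes
    to the limit. *)
Lemma approx_eigenspace x : (forall y, (forall n, '[y, u n] = 0) -> '[x, y] = 0) ->
  rnorm (P x - al%:C *: x) <= e * rnorm x.
Proof.
move=> hx; pose C z := scvg (E^~ z) z.
have bE n : BH (E n) by exact: BH_oproj.
have cC : closed_subspace C.
  split.
  - by move=> d d0; exists 0%N => n _; rewrite (BH0 (bE n)) subrr rnorm0.
  - move=> a y z hy hz; rewrite /C.
    have -> : (E^~ (a *: y + z)) = (fun n => a *: E n y + E n z).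
      by apply: funext => n; rewrite (BH_linear (bE n)).
    by apply: scvg_add => //; exact: (scvg_BH (BH_scale a BH_id)).
  - move=> w l hw wl d d0; have d3 : 0 < d / 2 by rewrite divr_gt0.
    have [N hN] := wl _ d3; have [K hK] := hw N _ d3.
    exists K => n Kn; have h1 := hK n Kn; have h2 := hN N (leqnn _).
    have := rnormD ((l - w N) - E n (l - w N)) (w N - E n (w N)).
    have -> : l - w N - E n (l - w N) + (w N - E n (w N)) = l - E n l.
      by rewrite addrACA subrK -opprD -(BHD (bE n)) subrK.
    have := BE_le n (l - w N); rewrite (rnormBC l (w N)) (rnormBC l) (rnormBC (w N) (E n _)); lra.
have Cu n : C (u n).
  move=> d d0; exists n.+1 => k nk.
  suff -> : E k (u n) = u n by rewrite subrr rnorm0.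
  rewrite E_eq (bigD1 (Ordinal nk)) //= ou eqxx scale1r big1 ?addr0 // => i ni.
  rewrite ou; case: eqP => [nE|]; last by rewrite scale0r.
  by move: ni; rewrite -val_eqE /= -nE eqxx.
have [p [Cp hp]] := projection x cC.
have xp : x = p.
  apply/eqP; rewrite -subr_eq0; apply/eqP/inner_eq0.
  rewrite innerBl (innerC p) hp // rmorph0 subr0.
  by apply: hx => n; exact: hp.
have {}Cp : C x by rewrite xp.
apply: (scvg_norm (scvg_BH bD Cp)) => n /=.
by apply: (le_trans (DE n x)); rewrite ler_wpM2l.
Qed.

End ApproximateEigenspace.

(** In finite dimension an isometry is onto, by [fredholm] applied to 1 - V. A kernel gap thus
    excludes the default value of [ess_min_modulus]. *)
Lemma gap_infdim (V : H -> H) b : BH V -> (forall x y, '[V x, V y] = '[x, y]) ->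
  adjoint V b = 0 -> '[b, b] = 1 -> infdim H.
Proof.
move=> bV iV Vb bb; apply: contrapT => /existsNP[F /forallNP hF].
have [G oG GF] := gram_schmidt F.
have zF x : orthol G x -> x = 0.
  move=> /GF xF; apply/eqP/negP => /negP x0; have x1 := rnorm_gt0 x0.
  apply: (hF ((rnorm x)^-1%:C *: x)); split.
    by rewrite rnormZ cabsR ger0_norm ?invr_ge0 ?rnorm_ge0 // mulVf ?gt_eqF.
  by move=> v vF; rewrite innerZl xF // mulr0.
have Ex x : oproj G x = x.
  by apply/eqP; rewrite eq_sym -subr_eq0; apply/eqP/zF; exact: oproj_ortho.
have fK : finrank (fun x => x - V x).
  apply: finrank_ext (finrank_sub (finrank_oproj G) (finrank_compl bV (finrank_oproj G))).
  by move=> x; rewrite Ex.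
have inj x : x - V x = x -> x = 0.
  move=> /(congr1 (fun y => x - y)); rewrite subKr subrr => Vx.
  by apply: inner_eq0; rewrite -iV Vx inner0l.
have [x hx] := fredholm fK inj b.
have : V x = b by rewrite -hx subKr.
move=> /(congr1 (fun y => '[y, b])); rewrite bb (adjointE bV) Vb inner0r.
by move/esym/eqP; rewrite oner_eq0.
Qed.

End UpperBounds.

(** * Unequal kernels: from a non-surjective isometry to a unitary operator *)

Section KernelGap.
Context {R : realType} {H : hilbertType R}.
Variables (T : H -> H) (A B : set H) (f : H -> H) (b : H).
Hypotheses (sepH : separable_space H) (bT : BH T).
Hypotheses (bA : orthonormal_basis (ker T) A) (bB : orthonormal_basis (ker (adjoint T)) B).
Hypotheses (fAB : forall a, A a -> B (f a)) (Bb : B b) (fb : forall a, A a -> f a <> b).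
Hypothesis finj : forall a a', A a -> A a' -> f a = f a' -> a = a'.

Let BT y : B y -> adjoint T y = 0. Proof. by case: bB => h _ _ /h. Qed.
Let oB x y : B x -> B y -> '[x, y] = (x == y)%:R. Proof. by case: bB => _ h _; exact: h. Qed.
Let of_ a a' : A a -> A a' -> '[f a, f a'] = (a == a')%:R.
Proof. exact: orthonormal_comp oB fAB finj a a'. Qed.

Lemma gap_isometry : exists V, [/\ BH V, forall x y, '[V x, V y] = '[x, y],
  forall x, V (absop T x) = T x & forall a, A a -> V a = f a].
Proof.
have [|gi gd] := polar_generators bT bA _ of_; first by move=> a /fAB/BT.
have [V [bV iV gV]] := isometry_extension gi gd.
exists V; split => // [x|a Aa]; apply: gV; [left; by exists x | right; by exists a].
Qed.

Section WithIsometry.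
Variable V : H -> H.
Hypotheses (bV : BH V) (iV : forall x y, '[V x, V y] = '[x, y]).
Hypotheses (VP : forall x, V (absop T x) = T x) (Vf : forall a, A a -> V a = f a).

Let nV x : rnorm (V x) = rnorm x.
Proof. by apply: eqr_sqr_nneg; rewrite ?rnorm_ge0 // -!rdotxx /rdot iV. Qed.

Let adjV y : B y -> (forall a, A a -> f a <> y) -> adjoint V y = 0.
Proof.
move=> By fy; have [AT _ mA] := bA; have [_ sP _ _] := absopP bT.
apply: mA.
  apply/(ker_absop _ bT)/inner_ext => z.
  by rewrite sP -(adjointE' bV) VP (adjointE' bT) BT // inner0l.
move=> a Aa; rewrite -(adjointE' bV) Vf // oB //; last exact: fAB.
by case: eqP => // /esym/fy; case.
Qed.

(** The range of [V] contains that of [T] and the vectors of [B] hit by [f]; the vectors of [B]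
    missed by [f] supply the rest. *)
Let ranV z : (forall x, '[z, V x] = 0) ->
    (forall y, B y -> (forall a, A a -> f a <> y) -> '[z, y] = 0) ->
  z = 0.
Proof.
move=> hz hB; have [_ _ mB] := bB; apply: mB.
  apply: inner_ext => y; by rewrite -(adjointE' bT) -VP hz.
move=> y By; have [[a Aa <-]|ny] := pselect (exists2 a, A a & f a = y).
  by rewrite -Vf.
by apply: hB => // a Aa fy; apply: ny; exists a.
Qed.

Lemma gap_infinite : infdim H.
Proof. by apply: (gap_infdim bV iV (adjV Bb fb)); rewrite oB // eqxx. Qed.

Section WithSequence.
Variables (al e : R) (u : nat -> H).
Let P := absop T.
Let M := opnorm T.
Let r := (M - al) / 2.
Hypotheses (e0 : 0 <= e) (al0 : 0 <= al) (alM : al <= M).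
Hypothesis ou : forall n m, '[u n, u m] = (n == m)%:R.
Hypothesis oPu : forall n m, n != m -> '[P (u n) - al%:C *: u n, P (u m) - al%:C *: u m] = 0.
Hypothesis hu : forall n, rnorm (P (u n) - al%:C *: u n) <= e.

(* The span of the u n is mapped onto the orthogonal complement of V (C), where
   C is the complement of the u n; both are infinite-dimensional and separable. *)
Lemma gap_unitary : exists2 U, unitary U & forall x, (forall n, '[x, u n] = 0) -> U x = V x.
Proof.
have Vu_inj : injective (V \o u).
  by apply: orthonormal_inj => n m; rewrite /= iV ou.
(* An orthonormal basis of the orthogonal complement of V (C): the images of the [u n] and the
   vectors of [B] missed by [f]. *)
pose Y := [set y | (exists n, y = V (u n)) \/ (B y /\ forall a, A a -> f a <> y)].
have oY : orthonormal_set Y.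
  move=> y y' [[n ->]|[By fy]] [[m ->]|[By' fy']].
  - by rewrite iV ou (inj_eq Vu_inj n m : (V (u n) == V (u m)) = _).
  - have o1 : '[V (u n), y'] = 0 by rewrite (adjointE bV) (adjV By' fy') inner0r.
    rewrite o1; case: eqP => // h; have : '[y', y'] = 0 by rewrite -{1}h.
    by rewrite oB // eqxx => /eqP; rewrite oner_eq0.
  - have o1 : '[y, V (u m)] = 0 by rewrite (adjointE' bV) (adjV By fy) inner0l.
    rewrite o1; case: eqP => // h; have : '[y, y] = 0 by rewrite {2}h.
    by rewrite oB // eqxx => /eqP; rewrite oner_eq0.
  - exact: oB.
(* Countable by separability and infinite because of the V (u n), whatever the size of the kernel
   gap. *)
have YN : Y #= [set: nat].
  apply: eq_card_nat; first exact: orthonormal_countable oY.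
  apply/infiniteP.
  have /card_eqPle[_ h] : (V \o u) @` [set: nat] #= [set: nat].
    by apply: inj_card_eq => n m _ _; exact: Vu_inj.
  apply: card_le_trans h _; apply: subset_card_le => _ [n _ <-].
  by left; exists n.
rewrite card_eq_sym in YN.
have /card_set_bijP[g [gY ginj gsurj]] := YN.
have Yg n : Y (g n) by exact: gY.
have og n m : '[g n, g m] = (n == m)%:R.
  apply: (orthonormal_comp (D := setT) oY) => // i j _ _.
  by apply: ginj; rewrite inE.
have Vg x n : (forall k, '[x, u k] = 0) -> '[V x, g n] = 0.
  move=> hx; case: (Yg n) => [[k ->]|[Bg fg]]; first by rewrite iV hx.
  by rewrite (adjointE bV) (adjV Bg fg) inner0r.
pose G x y := ((forall n, '[x, u n] = 0) /\ y = V x) \/ (exists n, x = u n /\ y = g n).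
have Gi x y x' y' : G x y -> G x' y' -> '[x, x'] = '[y, y'].
  move=> [[hx ->]|[n [-> ->]]] [[hx' ->]|[m [-> ->]]].
  - by rewrite iV.
  - by rewrite hx Vg.
  - by rewrite innerC hx' [RHS]innerC Vg.
  - by rewrite ou og.
have Gd z : (forall x y, G x y -> '[z, x] = 0) -> z = 0.
  move=> hz; apply: inner_eq0; apply: (hz _ (V z)); left; split => // n.
  by apply: (hz _ (g n)); right; exists n.
have Gr z : (forall x y, G x y -> '[z, y] = 0) -> z = 0.
  move=> hz.
  have zY y : Y y -> '[z, y] = 0.
    move=> /gsurj[n _ <-]; apply: (hz (u n)); right; by exists n.
  have zu n : '[adjoint V z, u n] = 0.
    by rewrite -(adjointE' bV) zY //; left; exists n.
  have Vz : adjoint V z = 0.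
    apply: inner_eq0; rewrite -(adjointE' bV).
    by apply: (hz (adjoint V z)); left.
  apply: ranV => [x|y By fy]; first by rewrite (adjointE' bV) Vz inner0l.
  by apply: zY; right.
have [U uU GU] := unitary_extension Gi Gd Gr.
by exists U => // x hx; apply: GU; left.
Qed.

(* Up to errors controlled by e, T - r U acts on C as V (P - r) and on the
   complement of C as al V - r U, with orthogonal ranges. *)
Lemma gap_estimate : exists2 U, unitary U &
  forall x, rnorm (T x - r%:C *: U x) <= (al + r + 2 * e) * rnorm x.
Proof.
have [U uU UV] := gap_unitary; exists U => // x.
have [bU iU _ _ nU] := unitaryP uU.
have [bP sP pP _] := absopP bT.
have r0 : 0 <= r by rewrite /r divr_ge0 // subr_ge0.
have ar : 0 <= al + r by rewrite addr_ge0.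
pose C := [set x | forall n, '[x, u n] = 0].
have cC : closed_subspace C := seq_ortho_closed ou.
have aC x' : (forall y, C y -> '[x', y] = 0) -> rnorm (P x' - al%:C *: x') <= e * rnorm x'.
  move=> h; exact: (approx_eigenspace bP e0 ou oPu hu h).
have [q [Cq hq]] := projection x cC.
set m := x - q in hq.
have xqm : x = q + m by rewrite /m addrC subrK.
pose h := P m - al%:C *: m.
have hh : rnorm h <= e * rnorm m by exact: aC.
(* [w] may leave [C], but its component [d] outside is small, since |d|^2 = <q, (P - al) d>. *)
pose w := P q - r%:C *: q.
have [c [Cc hc]] := projection w cC.
set d := w - c in hc.
have hd : rnorm d <= e * rnorm q.
  have [->|d0] := eqVneq d 0; first by rewrite rnorm0 mulr_ge0 ?rnorm_ge0.
  have d1 := rnorm_gt0 d0; rewrite -(ler_pM2r d1) -expr2 -rdotxx.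
  have qd : '[q, d] = 0 by rewrite innerC hc // rmorph0.
  have cd : '[c, d] = 0 by rewrite innerC hc // rmorph0.
  have -> : rdot d d = rdot q (P d - al%:C *: d).
    rewrite {1}/d rdotBl (rdot_inner cd) subr0 /w rdotBl rdotZl (rdot_inner qd).
    by rewrite rdotBr rdotZr (rdot_inner qd) !mulr0 !subr0 (selfadj_rdot sP).
  apply: (le_trans (cauchy_schwarz _ _)).
  by rewrite mulrAC [leRHS]mulrC ler_wpM2l ?rnorm_ge0 //; exact: aC.
(* Combines |P q|^2 <= M <P q, q> with al M + r^2 = (al + r)^2, which holds because 2 r = M - al. *)
have hw : rnorm w <= (al + r) * rnorm q.
  have uP y : rdot (P y) y <= M * rnorm y ^+ 2.
    apply: (le_trans (cauchy_schwarz _ _)).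
    by rewrite expr2 mulrA ler_wpM2r ?rnorm_ge0 //; exact: absop_bounded.
  have M0 : 0 <= M by exact: opnorm_ge0.
  have h1 := positive_norm_le bP sP pP M0 uP q.
  have h2 := uP q; have h3 := pP q.
  apply: ler_sqr_nneg; rewrite ?mulr_ge0 ?rnorm_ge0 //.
  rewrite /w rnormB2 rdotZr rnormZ cabsR ger0_norm //.
  rewrite [((al + r) * _) ^+ 2]exprMn [(r * _) ^+ 2]exprMn.
  have h4 : al * rdot (P q) q <= al * (M * rnorm q ^+ 2) by rewrite ler_wpM2l.
  have -> : (al + r) ^+ 2 * rnorm q ^+ 2 = al * (M * rnorm q ^+ 2) + r ^+ 2 * rnorm q ^+ 2.
    by rewrite /r; field.
  have -> : 2 * (r * rdot (P q) q) = (M - al) * rdot (P q) q by rewrite /r; field.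
  by rewrite -/P in h1 h3; lra.
have zid (a1 a2 a3 y z v : H) :
    a1 + (y + z) + (a2 + v) - (a1 + a3) = y + (a2 - a3) + (z + v).
  rewrite opprD -[a1 + (y + z) + (a2 + v)]addrA addrACA subrr add0r.
  by rewrite [RHS]addrACA -addrA; congr (_ + _); exact: addrAC.
(* [U] agrees with [V] on [C], which contains [q]; the errors [d] and [h] are at most e |q| and e
   |m|. *)
have dec : T x - r%:C *: U x = (V c + (al%:C *: V m - r%:C *: U m)) + V (d + h).
  rewrite -VP -/P xqm (BHD (bP : BH P)) (BHD bU) (UV _ Cq).
  have -> : P m = al%:C *: m + h by rewrite /h addrC subrK.
  have -> : P q = r%:C *: q + (c + d) by rewrite /d (addrC c) subrK /w addrC subrK.
  rewrite (BHD bV (_ + _)) (BHD bV (r%:C *: q)) (BHD bV c) (BHD bV (al%:C *: m)) (BHD bV d).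
  by rewrite (BHZ bV r%:C q) (BHZ bV al%:C m) (scalerDr r%:C (V q)); exact: zid.
have nd : rnorm (V (d + h)) <= e * (rnorm q + rnorm m).
  by rewrite nV (le_trans (rnormD _ _)) // mulrDr lerD.
have cm : '[c, m] = 0 by rewrite innerC hq // rmorph0.
have qm : '[q, m] = 0 by rewrite innerC hq // rmorph0.
have xqm2 : rnorm x ^+ 2 = rnorm q ^+ 2 + rnorm m ^+ 2 by rewrite xqm pythagoras.
have n1 : rnorm (V c + (al%:C *: V m - r%:C *: U m)) <= (al + r) * rnorm x.
  apply: ler_sqr_nneg; rewrite ?mulr_ge0 ?rnorm_ge0 //.
  (* V c is orthogonal to V m because [V] is isometric, and to U m because V c = U c and [U] is
     isometric. *)
  rewrite pythagoras; last first.
    rewrite innerBr !innerZr iV cm mulr0 -(UV _ Cc) iU cm mulr0 subr0 //.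
  rewrite nV exprMn xqm2 mulrDr -!exprMn lerD //.
    rewrite ler_pXn2r ?nnegrE ?mulr_ge0 ?rnorm_ge0 //.
    apply: le_trans hw; apply: ler_sqr_nneg; rewrite ?rnorm_ge0 //.
    have -> : w = c + d by rewrite /d addrC subrK.
    rewrite pythagoras ?lerDl ?sqr_ge0 //.
    by rewrite innerC hc // rmorph0.
  rewrite ler_pXn2r ?nnegrE ?mulr_ge0 ?rnorm_ge0 //.
  apply: (le_trans (rnormB _ _)).
  by rewrite !rnormZ !cabsR !ger0_norm // nV nU mulrDl.
have qx : rnorm q <= rnorm x.
  by apply: ler_sqr_nneg; rewrite ?rnorm_ge0 // xqm2 lerDl sqr_ge0.
have mx : rnorm m <= rnorm x.
  by apply: ler_sqr_nneg; rewrite ?rnorm_ge0 // xqm2 lerDr sqr_ge0.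
rewrite dec; apply: (le_trans (rnormD _ _)).
have : e * (rnorm q + rnorm m) <= e * (2 * rnorm x) by rewrite ler_wpM2l //; lra.
rewrite (mulrDl (al + r)) -mulrA (mulrCA 2); lra.
Qed.

End WithSequence.

Lemma gap_upper (e : R) : 0 < e -> exists l U, unitary U /\
  opnorm (fun x => T x - l *: U x) <= (opnorm T + ess_min_modulus T) / 2 + e.
Proof.
move=> e0; have [bP sP pP _] := absopP bT.
have [al0 wl _] := ess_min_modulusP bT gap_infinite.
set al := ess_min_modulus T in al0 wl *.
have alM : al <= opnorm T.
  apply: le_eps => d d0; have [x [x1 _ hx]] := wl d [::] d0.
  have := absop_bounded x bT; have := rnorm_lerB (al%:C *: x) (absop T x).
  rewrite rnormZ cabsR ger0_norm // x1 rnormBC; lra.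
have e2 : 0 < e / 2 by rewrite divr_gt0.
have [u [ou oPu hu]] := weyl_sequence bP sP wl e2.
have [U uU hU] := gap_estimate (ltW e2) al0 alM ou oPu hu.
exists ((opnorm T - al) / 2)%:C, U; split => //.
apply: opnorm_le => [|x].
  by have := opnorm_ge0 bT; lra.
apply: (le_trans (hU x)); rewrite ler_wpM2r ?rnorm_ge0 //; lra.
Qed.

End WithIsometry.
End KernelGap.

Section Main.
Context {R : realType} {H : hilbertType R}.

Lemma opdist_lt_kernels (T : H -> H) : separable_space H -> BH T ->
    hdim_lt (ker T) (ker (adjoint T)) ->
  opdist T (scaled_unitary H) = (opnorm T + ess_min_modulus T) / 2.
Proof.
move=> sepH bT [A [B [bA bB AB nBA]]].
have [AT oA mA] := bA; have [BT oB mB] := bB.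
(* If [A] were infinite, the countable set [B] would inject into it. *)
have finA : finite_set A.
  apply: contrapT => /infiniteP h; apply: nBA.
  exact: card_le_trans (orthonormal_countable sepH oB) h.
have [s As] := (finite_seqP A).1 finA.
have /pcard_leP/unsquash f := AB.
have fAB a : A a -> B (f a) by move=> Aa; exact: (@funS _ _ A B f).
have finj a a' : A a -> A a' -> f a = f a' -> a = a'.
  by move=> Aa Aa'; apply: (@inj _ _ A f); rewrite inE.
have [b Bb fb] : exists2 b, B b & forall a, A a -> f a <> b.
  apply: contrapT => h; apply: nBA.
  have /card_eqPle[h1 _] : f @` A #= A by apply: inj_card_eq; exact: (@inj _ _ A f).
  apply: card_le_trans h1; apply: subset_card_le => b Bb.
  by apply: contrapT => nb; apply: h; exists b => // a Aa fab; apply: nb; exists a.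
have Aus a : a \in undup s -> A a by rewrite mem_undup As.
have os : onlist (undup s).
  by split; [exact: undup_uniq | move=> x y /Aus Ax /Aus Ay; exact: oA].
have gap : kernel_gap T (undup s) f b.
  split=> //.
  - by move=> a /Aus/AT.
  - move=> x Tx h; apply: mA => // a Aa; apply: h.
    by rewrite mem_undup; move: Aa; rewrite As.
  - by move=> a /Aus/fAB/BT.
  - split.
      by move=> a a' /Aus Aa /Aus Aa'; exact: (orthonormal_comp oB fAB finj).
    split; [exact: BT | by rewrite oB // eqxx |].
    move=> a /Aus Aa; rewrite oB //; last exact: fAB.
    by case: eqP => // /fb; case.
have [V [bV iV VP Vf]] := gap_isometry bT bA bB fAB finj.
have infH := gap_infinite bT bA bB fAB Bb fb bV iV VP Vf.
apply: opdist_eq => [l U uU|e e0]; first exact: (gap_lower l bT gap infH uU).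
exact: (gap_upper sepH bT bA bB fAB Bb fb bV iV VP Vf e0).
Qed.

End Main.

Local Close Scope complex_scope.
Theorem theorem3p14 (R : realType) (H : hilbertType R)
    (sepH : separable_space H) (dimH : hdim_ge 2 [set: H])
    (T : H -> H) (hT : BH T) :
  [/\ hdim_lt (ker (adjoint T)) (ker T) ->
        opdist T (scaled_unitary H)
          = (opnorm T + ess_min_modulus (adjoint T)) / 2,
      hdim_lt (ker T) (ker (adjoint T)) ->
        opdist T (scaled_unitary H)
          = (opnorm T + ess_min_modulus T) / 2
    & hdim_eq (ker T) (ker (adjoint T)) ->
        opdist T (scaled_unitary H)
          = (opnorm T - min_modulus T) / 2].
Proof.
split.
- move=> h; rewrite -opdist_adjoint // -(opnorm_adjoint hT).
  apply: opdist_lt_kernels => //; first exact: BH_adjoint.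
  by rewrite adjointK.
- exact: opdist_lt_kernels.
- move=> [A [B [bA bB AB]]]; apply: opdist_eq_kernels bA bB AB => //.
  (* The dimension bound provides a unit vector, so the infimum defining [min_modulus] is over a
     nonempty set. *)
  have [D [_ oD _] /pcard_leP/unsquash f] := dimH.
  have D0 : D (f 0%N) by exact: (@funS _ _ `I_2 D f).
  exists (f 0%N); apply: eqr_sqr_nneg; rewrite ?rnorm_ge0 //.
  by rewrite expr1n -rdotxx /rdot oD // eqxx.
Qed.
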